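(* Let $k$ be a field of characteristic $0$. Every irreducible cocommutative Hopf $2$-algebra over $k$, i.e. every crossed module of Hopf algebras $\gamma:B\to H$ with $B$ and $H$ irreducible cocommutative Hopf algebras, is isomorphic (in the category of crossed modules of Hopf algebras) to an enveloping Hopf $2$-algebra, i.e. to one of the form $U(\mu:\mathfrak m\to\mathfrak n)$ where $\mu:\mathfrak m\to\mathfrak n$ is a crossed module of Lie algebras.
   Context: A Hopf algebra is irreducible if any two nonzero subcoalgebras intersect nontrivially (equivalently, $k\cdot 1$ is its unique simple subcoalgebra). A crossed module of Hopf algebras is a morphism of Hopf algebras $\gamma:B\to H$ with a left $H$-module structure on $B$ such that (i) $B$ is an $H$-module algebra and an $H$-module coalgebra; (ii) $\gamma(h\cdot b)=\sum h_1\gamma(b)S_H(h_2)$; (iii) $\gamma(b)\cdot b'=\sum b_1b'S_B(b_2)$ (Sweedler notation). A morphism to $\gamma':B'\to H'$ is a pair of Hopf algebra morphisms $\rho:B\to B'$, $\sigma:H\to H'$ with $\gamma'\rho=\sigma\gamma$ and $\rho(h\cdot b)=\sigma(h)\cdot\rho(b)$. A crossed module of Lie algebras is a homomorphism $\mu:\mathfrak m\to\mathfrak n$ with an action of $\mathfrak n$ on $\mathfrak m$ by derivations such that $\mu(n\cdot m)=[n,\mu(m)]$ and $\mu(m)\cdot m'=[m,m']$. $U(\mu:\mathfrak m\to\mathfrak n)$ is the crossed module of Hopf algebras $U\mu:U\mathfrak m\to U\mathfrak n$ where $U\mathfrak n$ acts on $U\mathfrak m$ by the canonical extension of the action, $\mathfrak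 n$ acting by derivations of the associative product. *)

(* Defs.v *)
From HB Require Import structures.
From mathcomp Require Import all_boot all_order all_algebra.
From mathcomp Require Import boolp classical_sets.

Set Implicit Arguments.
Unset Strict Implicit.
Unset Printing Implicit Defensive.

Import GRing.Theory.
Local Open Scope ring_scope.
Local Open Scope quotient_scope.

Definition is_bilinear (k : fieldType) (U V W : lmodType k) (f : U -> V -> W) :
    Prop :=
  (forall v, linear (f^~ v)) /\ (forall u, linear (f u)).

Section Unbundled.
Variables (k : fieldType).

Section Linear.
Variables (U V : lmodType k) (f : U -> V).
Hypothesis fL : linear f.

Lemma linD u v : f (u + v) = f u + f v.
Proof. by rewrite -[u]scale1r fL !scale1r. Qed.

Lemma lin0 : f 0 = 0.
Proof. by apply: (addIr (f 0)); rewrite -linD !add0r. Qed.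

Lemma linZ a u : f (a *: u) = a *: f u.
Proof. by rewrite -[_ *: u]addr0 fL lin0 addr0. Qed.

Lemma linN u : f (- u) = - f u.
Proof. by rewrite -scaleN1r linZ scaleN1r. Qed.
End Linear.

Section Bilinear.
Variables (U V W : lmodType k) (f : U -> V -> W).
Hypothesis fB : is_bilinear f.

Lemma bilDl u u' v : f (u + u') v = f u v + f u' v.
Proof. exact: (linD (fB.1 v)). Qed.
Lemma bilDr u v v' : f u (v + v') = f u v + f u v'.
Proof. exact: (linD (fB.2 u)). Qed.
Lemma bil0l v : f 0 v = 0.
Proof. exact: (lin0 (fB.1 v)). Qed.
Lemma bil0r u : f u 0 = 0.
Proof. exact: (lin0 (fB.2 u)). Qed.
Lemma bilZl a u v : f (a *: u) v = a *: f u v.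
Proof. exact: (linZ (fB.1 v)). Qed.
Lemma bilZr a u v : f u (a *: v) = a *: f u v.
Proof. exact: (linZ (fB.2 u)). Qed.
Lemma bilNl u v : f (- u) v = - f u v.
Proof. exact: (linN (fB.1 v)). Qed.
Lemma bilNr u v : f u (- v) = - f u v.
Proof. exact: (linN (fB.2 u)). Qed.
End Bilinear.
End Unbundled.

(** * Tensor product of vector spaces

    [tensor V W] is presented by generators and relations: terms built from the
    symbols [v ⊗ w], modulo the least congruence making them a [k]-vector space
    in which [⊗] is bilinear. *)

Section TensorDef.
Variables (k : fieldType) (V W : lmodType k).

Inductive tens_term : Type :=
| TPure of V & W
| TZero
| TAdd of tens_term & tens_term
| TScale of k & tens_term.

Inductive tens_eqv : tens_term -> tens_term -> Prop :=
| TE_refl s : tens_eqv s s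
| TE_sym s t : tens_eqv s t -> tens_eqv t s
| TE_trans s t u : tens_eqv s t -> tens_eqv t u -> tens_eqv s u
| TE_add s s' t t' :
    tens_eqv s s' -> tens_eqv t t' -> tens_eqv (TAdd s t) (TAdd s' t')
| TE_scale a s s' : tens_eqv s s' -> tens_eqv (TScale a s) (TScale a s')
| TE_addA s t u : tens_eqv (TAdd s (TAdd t u)) (TAdd (TAdd s t) u)
| TE_addC s t : tens_eqv (TAdd s t) (TAdd t s)
| TE_add0 s : tens_eqv (TAdd TZero s) s
| TE_scaleA a b s : tens_eqv (TScale a (TScale b s)) (TScale (a * b) s)
| TE_scale0 s : tens_eqv (TScale 0 s) TZero
| TE_scale1 s : tens_eqv (TScale 1 s) s
| TE_scaleDr a s t :
    tens_eqv (TScale a (TAdd s t)) (TAdd (TScale a s) (TScale a t))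
| TE_scaleDl a b s :
    tens_eqv (TScale (a + b) s) (TAdd (TScale a s) (TScale b s))
| TE_pureDl v v' w : tens_eqv (TPure (v + v') w) (TAdd (TPure v w) (TPure v' w))
| TE_pureDr v w w' : tens_eqv (TPure v (w + w')) (TAdd (TPure v w) (TPure v w'))
| TE_pureZl a v w : tens_eqv (TPure (a *: v) w) (TScale a (TPure v w))
| TE_pureZr a v w : tens_eqv (TPure v (a *: w)) (TScale a (TPure v w)).

HB.instance Definition _ := gen_eqMixin tens_term.
HB.instance Definition _ := gen_choiceMixin tens_term.

Definition tens_rel (s t : tens_term) : bool := `[< tens_eqv s t >].

Lemma tens_rel_refl : reflexive tens_rel.
Proof. by move=> s; apply/asboolP; apply: TE_refl. Qed.

Lemma tens_rel_sym : symmetric tens_rel.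
Proof. by move=> s t; apply/asboolP/asboolP; apply: TE_sym. Qed.

Lemma tens_rel_trans : transitive tens_rel.
Proof.
move=> t s u /asboolP st /asboolP tu; apply/asboolP; exact: TE_trans st tu.
Qed.

Canonical tens_rel_equiv :=
  EquivRel tens_rel tens_rel_refl tens_rel_sym tens_rel_trans.

Definition tensor : Type := {eq_quot tens_rel}.

HB.instance Definition _ := Choice.on tensor.
HB.instance Definition _ := EqQuotient.on tensor.

Definition tens_cls (s : tens_term) : tensor := \pi s.
Local Notation cls := tens_cls.

Lemma tens_clsW (P : tensor -> Prop) : (forall s, P (cls s)) -> forall x, P x.
Proof. exact: quotW. Qed.

Lemma tens_piP s t : tens_eqv s t <-> cls s = cls t.
Proof.
split=> [st|/eqmodP st]; first by apply/eqmodP/asboolP.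
by move: st; rewrite /= /tens_rel => /asboolP.
Qed.

Lemma tens_reprK s : tens_eqv (repr (cls s)) s.
Proof. by apply/tens_piP; rewrite /cls reprK. Qed.

Definition tens (v : V) (w : W) : tensor := cls (TPure v w).
Definition tens_zero : tensor := cls TZero.
Definition tens_add (x y : tensor) : tensor := cls (TAdd (repr x) (repr y)).
Definition tens_scale (a : k) (x : tensor) : tensor := cls (TScale a (repr x)).
Definition tens_opp (x : tensor) : tensor := tens_scale (-1) x.
Local Notation zero := tens_zero.
Local Notation add := tens_add.
Local Notation scale := tens_scale.
Local Notation opp := tens_opp.

Let addE s t : add (cls s) (cls t) = cls (TAdd s t).
Proof. by apply/tens_piP; apply: TE_add; apply: tens_reprK. Qed.

Let scaleE a s : scale a (cls s) = cls (TScale a s).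
Proof. by apply/tens_piP; apply: TE_scale; apply: tens_reprK. Qed.

Let tensor_addA : associative add.
Proof.
elim/tens_clsW=> s; elim/tens_clsW=> t; elim/tens_clsW=> u.
by rewrite !addE; apply/tens_piP; apply: TE_addA.
Qed.

Let tensor_addC : commutative add.
Proof.
by elim/tens_clsW=> s; elim/tens_clsW=> t; rewrite !addE; apply/tens_piP; apply: TE_addC.
Qed.

Let tensor_add0 : left_id zero add.
Proof. by elim/tens_clsW=> s; rewrite addE; apply/tens_piP; apply: TE_add0. Qed.

Let tensor_scale0 x : scale 0 x = zero.
Proof. by elim/tens_clsW: x => s; rewrite scaleE; apply/tens_piP; apply: TE_scale0. Qed.

Let tensor_scale1 : left_id 1 scale.
Proof. by elim/tens_clsW=> s; rewrite scaleE; apply/tens_piP; apply: TE_scale1. Qed.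

Let tensor_scaleA a b x : scale a (scale b x) = scale (a * b) x.
Proof. by elim/tens_clsW: x => s; rewrite !scaleE; apply/tens_piP; apply: TE_scaleA. Qed.

Let tensor_scaleDr : right_distributive scale add.
Proof.
move=> a; elim/tens_clsW=> s; elim/tens_clsW=> t; rewrite !(scaleE, addE).
by apply/tens_piP; apply: TE_scaleDr.
Qed.

Let tensor_scaleDl x : {morph scale^~ x : a b / a + b >-> add a b}.
Proof.
elim/tens_clsW: x => s a b; rewrite !(scaleE, addE).
by apply/tens_piP; apply: TE_scaleDl.
Qed.

Let tensor_addN : left_inverse zero opp add.
Proof.
move=> x; rewrite -[x in add _ x]tensor_scale1 /opp -tensor_scaleDl.
by rewrite addNr tensor_scale0.
Qed.

HB.instance Definition _ := GRing.isZmodule.Build tensor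
  tensor_addA tensor_addC tensor_add0 tensor_addN.
HB.instance Definition _ := GRing.Zmodule_isLmodule.Build k tensor
  tensor_scaleA tensor_scale1 tensor_scaleDr tensor_scaleDl.

Lemma tens_clsD s t : cls (TAdd s t) = cls s + cls t.
Proof. by rewrite -addE. Qed.

Lemma tens_clsZ a s : cls (TScale a s) = a *: cls s.
Proof. by rewrite -scaleE. Qed.

Lemma tens_is_bilinear : is_bilinear tens.
Proof.
split=> [w a v v'|v a w w']; rewrite /tens /= -tens_clsZ -tens_clsD.
  apply/tens_piP; apply: TE_trans (TE_pureDl _ _ _) _.
  by apply: TE_add; [apply: TE_pureZl | apply: TE_refl].
apply/tens_piP; apply: TE_trans (TE_pureDr _ _ _) _.
by apply: TE_add; [apply: TE_pureZr | apply: TE_refl].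
Qed.

Lemma tensor_ind (P : tensor -> Prop) :
    (forall v w, P (tens v w)) -> P 0 ->
    (forall x y, P x -> P y -> P (x + y)) ->
    (forall a x, P x -> P (a *: x)) ->
  forall x, P x.
Proof.
move=> Pt P0 PD PZ; elim/tens_clsW; elim=> [v w||s Ps t Pt'|a s Ps].
- exact: Pt.
- exact: P0.
- by rewrite tens_clsD; apply: PD.
- by rewrite tens_clsZ; apply: PZ.
Qed.

Section Lift.
Variable U : lmodType k.

Fixpoint tens_eval (f : V -> W -> U) (s : tens_term) : U :=
  match s with
  | TPure v w => f v w
  | TZero => 0
  | TAdd s t => tens_eval f s + tens_eval f t
  | TScale a s => a *: tens_eval f s
  end.

(** [tens_lift f] is the linear map sending [v ⊗ w] to [f v w] whenever [f] is
    bilinear; on other functions it is total but meaningless. *)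
Definition tens_lift (f : V -> W -> U) (x : tensor) : U := tens_eval f (repr x).

Lemma tens_evalP f s t : is_bilinear f -> tens_eqv s t ->
  tens_eval f s = tens_eval f t.
Proof.
move=> fB; elim=> //=.
- by move=> ? ? ? _ -> _ ->.
- by move=> ? ? ? ? _ -> _ ->.
- by move=> ? ? ? _ ->.
- by move=> *; rewrite addrA.
- by move=> *; rewrite addrC.
- by move=> *; rewrite add0r.
- by move=> *; rewrite scalerA.
- by move=> *; rewrite scale0r.
- by move=> *; rewrite scale1r.
- by move=> *; rewrite scalerDr.
- by move=> *; rewrite scalerDl.
- by move=> *; rewrite (bilDl fB).
- by move=> *; rewrite (bilDr fB).
- by move=> *; rewrite (bilZl fB).
- by move=> *; rewrite (bilZr fB).
Qed.

Lemma tens_liftE f v w : is_bilinear f -> tens_lift f (tens v w) = f v w.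
Proof. by move=> fB; rewrite /tens_lift (tens_evalP fB (tens_reprK _)). Qed.

Lemma tens_lift_linear f : is_bilinear f -> linear (tens_lift f).
Proof.
move=> fB a; elim/tens_clsW=> s; elim/tens_clsW=> t.
by rewrite -tens_clsZ -tens_clsD /tens_lift !(tens_evalP fB (tens_reprK _)).
Qed.

Lemma tens_lift_add f g x :
  tens_lift (fun v w => f v w + g v w) x = tens_lift f x + tens_lift g x.
Proof.
rewrite /tens_lift; elim: (repr x) => //= [|s -> t ->|a s ->].
- by rewrite addr0.
- by rewrite addrACA.
- by rewrite scalerDr.
Qed.

Lemma tens_lift_scale a f x :
  tens_lift (fun v w => a *: f v w) x = a *: tens_lift f x.
Proof.
rewrite /tens_lift; elim: (repr x) => //= [|s -> t ->|b s ->].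
- by rewrite scaler0.
- by rewrite scalerDr.
- by rewrite !scalerA mulrC.
Qed.

Lemma eq_tens_lift f g : (forall v w, f v w = g v w) ->
  tens_lift f =1 tens_lift g.
Proof.
by move=> fg x; rewrite /tens_lift; elim: (repr x) => //= [s -> t ->|b s ->].
Qed.

End Lift.

Lemma linear_tens_lift (U U' : lmodType k) (g : U -> U') (f : V -> W -> U) x :
  linear g -> g (tens_lift f x) = tens_lift (fun v w => g (f v w)) x.
Proof.
move=> gL; rewrite /tens_lift.
elim: (repr x) => [//||s IHs t IHt|b s IHs] /=.
- exact: (lin0 gL).
- by rewrite (linD gL) IHs IHt.
- by rewrite (linZ gL) IHs.
Qed.

End TensorDef.

Notation "v ⊗ w" := (tens v w) (at level 40, left associativity) : ring_scope.

Section TensorTheory.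
Variable k : fieldType.

Lemma tens_ext (V W U : lmodType k) (f g : tensor V W -> U) :
  linear f -> linear g -> (forall v w, f (v ⊗ w) = g (v ⊗ w)) -> f =1 g.
Proof.
move=> fL gL fg; elim/tensor_ind=> // [|x y fx fy|a x fx].
- by rewrite (lin0 fL) (lin0 gL).
- by rewrite (linD fL) (linD gL) fx fy.
- by rewrite (linZ fL) (linZ gL) fx.
Qed.

Lemma tens_lift_bilinear (V W V' W' U : lmodType k)
    (F : V' -> W' -> V -> W -> U) (x : tensor V W) :
    (forall v w, is_bilinear (fun v' w' => F v' w' v w)) ->
  is_bilinear (fun v' w' => tens_lift (F v' w') x).
Proof.
move=> FB; split=> [w' a u u'|v' a u u'] /=;
  rewrite -tens_lift_scale -tens_lift_add; apply: eq_tens_lift => v w.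
  exact: (FB v w).1.
exact: (FB v w).2.
Qed.

Definition tensDl (V W : lmodType k) := bilDl (@tens_is_bilinear k V W).
Definition tensDr (V W : lmodType k) := bilDr (@tens_is_bilinear k V W).
Definition tensZl (V W : lmodType k) := bilZl (@tens_is_bilinear k V W).
Definition tensZr (V W : lmodType k) := bilZr (@tens_is_bilinear k V W).
Definition tens0l (V W : lmodType k) := bil0l (@tens_is_bilinear k V W).
Definition tens0r (V W : lmodType k) := bil0r (@tens_is_bilinear k V W).
Definition tensNl (V W : lmodType k) := bilNl (@tens_is_bilinear k V W).
Definition tensNr (V W : lmodType k) := bilNr (@tens_is_bilinear k V W).

End TensorTheory.

(** ** The algebra [A ⊗ B], with [(a ⊗ b) (a' ⊗ b') = a a' ⊗ b b'] *)

Section TensorAlgebra.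
Variables (k : fieldType) (A B : algType k).

Definition tens_mul (x y : tensor A B) : tensor A B :=
  tens_lift (fun a b => tens_lift (fun a' b' => (a * a') ⊗ (b * b')) y) x.

Let mul_bil1 a b : is_bilinear (fun (a' : A) (b' : B) => (a * a') ⊗ (b * b')).
Proof.
split=> [? ? ? ?|? ? ? ?] /=; rewrite mulrDr -scalerAr.
  by rewrite tensDl tensZl.
by rewrite tensDr tensZr.
Qed.

Let mul_bil2 y : is_bilinear (fun (a : A) (b : B) =>
  tens_lift (fun (a' : A) (b' : B) => (a * a') ⊗ (b * b')) y).
Proof.
apply: tens_lift_bilinear => a' b'.
split=> [? ? ? ?|? ? ? ?] /=; rewrite mulrDl -scalerAl.
  by rewrite tensDl tensZl.
by rewrite tensDr tensZr.
Qed.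

Lemma tens_mulE a b a' b' :
  tens_mul (a ⊗ b) (a' ⊗ b') = (a * a') ⊗ (b * b').
Proof. by rewrite /tens_mul !tens_liftE. Qed.

Lemma tens_mul_bilinear : is_bilinear tens_mul.
Proof.
split=> [y|x]; first exact: tens_lift_linear (mul_bil2 y).
move=> c u v; rewrite /tens_mul -tens_lift_scale -tens_lift_add.
by apply: eq_tens_lift => a b; rewrite (tens_lift_linear (mul_bil1 a b)).
Qed.

Let mulB := tens_mul_bilinear.
Let tmulE := (bilDl mulB, bilDr mulB, bilZl mulB, bilZr mulB, bil0l mulB, bil0r mulB).

Let tens_mulA : associative tens_mul.
Proof.
elim/tensor_ind=> [a b|||]; first last.
- by move=> c x IH y z; rewrite !tmulE IH.
- by move=> x y IHx IHy z t; rewrite !tmulE IHx IHy.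
- by move=> y z; rewrite !tmulE.
elim/tensor_ind=> [a' b'|||]; first last.
- by move=> c x IH z; rewrite !tmulE IH.
- by move=> x y IHx IHy z; rewrite !tmulE IHx IHy.
- by move=> z; rewrite !tmulE.
elim/tensor_ind=> [a'' b''|||]; first last.
- by move=> c x IH; rewrite !tmulE IH.
- by move=> x y IHx IHy; rewrite !tmulE IHx IHy.
- by rewrite !tmulE.
by rewrite !tens_mulE !mulrA.
Qed.

Let tens_mul1l : left_id (1 ⊗ 1) tens_mul.
Proof.
elim/tensor_ind=> [a b||x y IHx IHy|c x IHx]; first by rewrite tens_mulE !mul1r.
- by rewrite !tmulE.
- by rewrite !tmulE IHx IHy.
- by rewrite !tmulE IHx.
Qed.

Let tens_mul1r : right_id (1 ⊗ 1) tens_mul.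
Proof.
elim/tensor_ind=> [a b||x y IHx IHy|c x IHx]; first by rewrite tens_mulE !mulr1.
- by rewrite !tmulE.
- by rewrite !tmulE IHx IHy.
- by rewrite !tmulE IHx.
Qed.

Let tens_mulDl : left_distributive tens_mul +%R.
Proof. by move=> x y z; rewrite !tmulE. Qed.

Let tens_mulDr : right_distributive tens_mul +%R.
Proof. by move=> x y z; rewrite !tmulE. Qed.

HB.instance Definition _ := GRing.Zmodule_isPzRing.Build (tensor A B)
  tens_mulA tens_mul1l tens_mul1r tens_mulDl tens_mulDr.

Lemma tensor_mulE (a a' : A) (b b' : B) :
  (a ⊗ b) * (a' ⊗ b') = (a * a') ⊗ (b * b') :> tensor A B.
Proof. exact: tens_mulE. Qed.

Lemma tensor_mul_bilinear : is_bilinear (fun x y : tensor A B => x * y).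
Proof. exact: tens_mul_bilinear. Qed.

End TensorAlgebra.

(** * Coalgebras and Hopf algebras

    Sweedler sums [∑ E(c₁, c₂)] are rendered as [tens_lift (fun c1 c2 => E) (comul c)]. *)

HB.mixin Record Lmodule_isCoalgebra (k : fieldType) C of GRing.Lmodule k C := {
  comul : C -> tensor C C;
  counit : C -> k;
  comul_linear : linear comul;
  counit_linear : scalar counit;
  comulA : forall c,
    tens_lift (fun c1 c2 => tens_lift (fun c11 c12 => c11 ⊗ (c12 ⊗ c2)) (comul c1))
      (comul c)
    = tens_lift (fun c1 c2 => c1 ⊗ comul c2) (comul c);
  counitl : forall c, tens_lift (fun c1 c2 => counit c1 *: c2) (comul c) = c;
  counitr : forall c, tens_lift (fun c1 c2 => counit c2 *: c1) (comul c) = c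
}.

#[short(type="coalgType")]
HB.structure Definition Coalgebra (k : fieldType) :=
  {C of GRing.Lmodule k C & Lmodule_isCoalgebra k C}.

HB.mixin Record Algebra_Coalgebra_isHopf (k : fieldType) H
    of GRing.Algebra k H & Coalgebra k H := {
  comulM : forall g h : H, comul (g * h) = comul g * comul h;
  comul1 : comul (1 : H) = 1 ⊗ 1;
  counitM : forall g h : H, counit (g * h) = counit g * counit h;
  counit1 : counit (1 : H) = 1;
  antipode : H -> H;
  antipode_linear : linear antipode;
  antipodel : forall h : H,
    tens_lift (fun h1 h2 => antipode h1 * h2) (comul h) = (counit h)%:A;
  antipoder : forall h : H,
    tens_lift (fun h1 h2 => h1 * antipode h2) (comul h) = (counit h)%:A
}.

#[short(type="hopfAlgType")]
HB.structure Definition HopfAlgebra (k : fieldType) :=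
  {H of GRing.Algebra k H & Coalgebra k H & Algebra_Coalgebra_isHopf k H}.

Notation "\sw_ ( c , d <- x ) E" := (tens_lift (fun c d => E) (comul x))
  (at level 41, c name, d name, x at level 50, E at level 41, right associativity) : ring_scope.

HB.mixin Record Lmodule_isLie (k : fieldType) L of GRing.Lmodule k L := {
  lie : L -> L -> L;
  lie_bilinear : is_bilinear lie;
  liexx : forall x, lie x x = 0;
  lie_jacobi : forall x y z,
    lie x (lie y z) + lie y (lie z x) + lie z (lie x y) = 0
}.

#[short(type="lieAlgType")]
HB.structure Definition LieAlgebra (k : fieldType) :=
  {L of GRing.Lmodule k L & Lmodule_isLie k L}.

(** * Universal enveloping algebra

    [envalg L] is the associative unital [k]-algebra generated by the symbols
    [env_in x], [x \in L], subject to linearity of [env_in] and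
    [env_in [x, y] = env_in x * env_in y - env_in y * env_in x]. *)

Section EnvDef.
Variables (k : fieldType) (L : lieAlgType k).

Inductive env_term : Type :=
| EVar of L
| EZero
| EAdd of env_term & env_term
| EScale of k & env_term
| EOne
| EMul of env_term & env_term.

Inductive env_eqv : env_term -> env_term -> Prop :=
| EE_refl s : env_eqv s s
| EE_sym s t : env_eqv s t -> env_eqv t s
| EE_trans s t u : env_eqv s t -> env_eqv t u -> env_eqv s u
| EE_add s s' t t' :
    env_eqv s s' -> env_eqv t t' -> env_eqv (EAdd s t) (EAdd s' t')
| EE_scale a s s' : env_eqv s s' -> env_eqv (EScale a s) (EScale a s')
| EE_mul s s' t t' :
    env_eqv s s' -> env_eqv t t' -> env_eqv (EMul s t) (EMul s' t')
| EE_addA s t u : env_eqv (EAdd s (EAdd t u)) (EAdd (EAdd s t) u)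
| EE_addC s t : env_eqv (EAdd s t) (EAdd t s)
| EE_add0 s : env_eqv (EAdd EZero s) s
| EE_scaleA a b s : env_eqv (EScale a (EScale b s)) (EScale (a * b) s)
| EE_scale0 s : env_eqv (EScale 0 s) EZero
| EE_scale1 s : env_eqv (EScale 1 s) s
| EE_scaleDr a s t :
    env_eqv (EScale a (EAdd s t)) (EAdd (EScale a s) (EScale a t))
| EE_scaleDl a b s :
    env_eqv (EScale (a + b) s) (EAdd (EScale a s) (EScale b s))
| EE_mulA s t u : env_eqv (EMul s (EMul t u)) (EMul (EMul s t) u)
| EE_mul1l s : env_eqv (EMul EOne s) s
| EE_mul1r s : env_eqv (EMul s EOne) s
| EE_mulDl s t u : env_eqv (EMul (EAdd s t) u) (EAdd (EMul s u) (EMul t u))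
| EE_mulDr s t u : env_eqv (EMul s (EAdd t u)) (EAdd (EMul s t) (EMul s u))
| EE_mulZl a s t : env_eqv (EMul (EScale a s) t) (EScale a (EMul s t))
| EE_mulZr a s t : env_eqv (EMul s (EScale a t)) (EScale a (EMul s t))
| EE_varD x y : env_eqv (EVar (x + y)) (EAdd (EVar x) (EVar y))
| EE_varZ a x : env_eqv (EVar (a *: x)) (EScale a (EVar x))
| EE_varL x y : env_eqv (EVar (lie x y))
    (EAdd (EMul (EVar x) (EVar y)) (EScale (-1) (EMul (EVar y) (EVar x)))).

HB.instance Definition _ := gen_eqMixin env_term.
HB.instance Definition _ := gen_choiceMixin env_term.

Definition env_rel (s t : env_term) : bool := `[< env_eqv s t >].

Lemma env_rel_refl : reflexive env_rel.
Proof. by move=> s; apply/asboolP; apply: EE_refl. Qed.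

Lemma env_rel_sym : symmetric env_rel.
Proof. by move=> s t; apply/asboolP/asboolP; apply: EE_sym. Qed.

Lemma env_rel_trans : transitive env_rel.
Proof.
move=> t s u /asboolP st /asboolP tu; apply/asboolP; exact: EE_trans st tu.
Qed.

Canonical env_rel_equiv :=
  EquivRel env_rel env_rel_refl env_rel_sym env_rel_trans.

Definition envalg : Type := {eq_quot env_rel}.

HB.instance Definition _ := Choice.on envalg.
HB.instance Definition _ := EqQuotient.on envalg.

Definition env_cls (s : env_term) : envalg := \pi s.
Local Notation cls := env_cls.

Lemma env_clsW (P : envalg -> Prop) : (forall s, P (cls s)) -> forall x, P x.
Proof. exact: quotW. Qed.

Lemma env_piP s t : env_eqv s t <-> cls s = cls t.
Proof.
split=> [st|/eqmodP st]; first by apply/eqmodP/asboolP.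
by move: st; rewrite /= /env_rel => /asboolP.
Qed.

Lemma env_reprK s : env_eqv (repr (cls s)) s.
Proof. by apply/env_piP; rewrite /cls reprK. Qed.

Definition env_in (x : L) : envalg := cls (EVar x).

Definition env_zero : envalg := cls EZero.
Definition env_one : envalg := cls EOne.
Definition env_add (x y : envalg) : envalg := cls (EAdd (repr x) (repr y)).
Definition env_mul (x y : envalg) : envalg := cls (EMul (repr x) (repr y)).
Definition env_scale (a : k) (x : envalg) : envalg := cls (EScale a (repr x)).
Definition env_opp (x : envalg) : envalg := env_scale (-1) x.
Local Notation add := env_add.
Local Notation mul := env_mul.
Local Notation scale := env_scale.

Let addE s t : add (cls s) (cls t) = cls (EAdd s t).
Proof. by apply/env_piP; apply: EE_add; apply: env_reprK. Qed.

Let mulE s t : mul (cls s) (cls t) = cls (EMul s t).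
Proof. by apply/env_piP; apply: EE_mul; apply: env_reprK. Qed.

Let scaleE a s : scale a (cls s) = cls (EScale a s).
Proof. by apply/env_piP; apply: EE_scale; apply: env_reprK. Qed.

Let opE := (addE, mulE, scaleE).

Let env_addA : associative add.
Proof.
elim/env_clsW=> s; elim/env_clsW=> t; elim/env_clsW=> u.
by rewrite !opE; apply/env_piP; apply: EE_addA.
Qed.

Let env_addC : commutative add.
Proof.
by elim/env_clsW=> s; elim/env_clsW=> t; rewrite !opE; apply/env_piP; apply: EE_addC.
Qed.

Let env_add0 : left_id env_zero add.
Proof. by elim/env_clsW=> s; rewrite opE; apply/env_piP; apply: EE_add0. Qed.

Let env_scale0 x : scale 0 x = env_zero.
Proof. by elim/env_clsW: x => s; rewrite opE; apply/env_piP; apply: EE_scale0. Qed.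

Let env_scale1 : left_id 1 scale.
Proof. by elim/env_clsW=> s; rewrite opE; apply/env_piP; apply: EE_scale1. Qed.

Let env_scaleA a b x : scale a (scale b x) = scale (a * b) x.
Proof. by elim/env_clsW: x => s; rewrite !opE; apply/env_piP; apply: EE_scaleA. Qed.

Let env_scaleDr : right_distributive scale add.
Proof.
move=> a; elim/env_clsW=> s; elim/env_clsW=> t; rewrite !opE.
by apply/env_piP; apply: EE_scaleDr.
Qed.

Let env_scaleDl x : {morph scale^~ x : a b / a + b >-> add a b}.
Proof.
by elim/env_clsW: x => s a b; rewrite !opE; apply/env_piP; apply: EE_scaleDl.
Qed.

Let env_addN : left_inverse env_zero env_opp add.
Proof.
move=> x; rewrite -[x in add _ x]env_scale1 /env_opp -env_scaleDl.
by rewrite addNr env_scale0.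
Qed.

HB.instance Definition _ := GRing.isZmodule.Build envalg
  env_addA env_addC env_add0 env_addN.
HB.instance Definition _ := GRing.Zmodule_isLmodule.Build k envalg
  env_scaleA env_scale1 env_scaleDr env_scaleDl.

Lemma env_clsD s t : cls (EAdd s t) = cls s + cls t.
Proof. by rewrite -addE. Qed.

Lemma env_clsZ a s : cls (EScale a s) = a *: cls s.
Proof. by rewrite -scaleE. Qed.

Let env_mulA : associative mul.
Proof.
elim/env_clsW=> s; elim/env_clsW=> t; elim/env_clsW=> u.
by rewrite !opE; apply/env_piP; apply: EE_mulA.
Qed.

Let env_mul1l : left_id env_one mul.
Proof. by elim/env_clsW=> s; rewrite opE; apply/env_piP; apply: EE_mul1l. Qed.

Let env_mul1r : right_id env_one mul.
Proof. by elim/env_clsW=> s; rewrite opE; apply/env_piP; apply: EE_mul1r. Qed.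

Let env_mulDl : left_distributive mul +%R.
Proof.
elim/env_clsW=> s; elim/env_clsW=> t; elim/env_clsW=> u.
by rewrite -env_clsD !opE -env_clsD; apply/env_piP; apply: EE_mulDl.
Qed.

Let env_mulDr : right_distributive mul +%R.
Proof.
elim/env_clsW=> s; elim/env_clsW=> t; elim/env_clsW=> u.
by rewrite -env_clsD !opE -env_clsD; apply/env_piP; apply: EE_mulDr.
Qed.

Let env_mulZl a x y : mul (a *: x) y = a *: mul x y.
Proof.
elim/env_clsW: x => s; elim/env_clsW: y => t.
by rewrite -env_clsZ !opE -env_clsZ; apply/env_piP; apply: EE_mulZl.
Qed.

Let env_mulZr a x y : mul x (a *: y) = a *: mul x y.
Proof.
elim/env_clsW: x => s; elim/env_clsW: y => t.
by rewrite -env_clsZ !opE -env_clsZ; apply/env_piP; apply: EE_mulZr.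
Qed.

(** Evaluation of terms in a (possibly zero) associative algebra, given by its
    unit [one] and product [mulA]. *)
Section Eval.
Variables (A : lmodType k) (one : A) (mulA : A -> A -> A).

Fixpoint env_eval (f : L -> A) (s : env_term) : A :=
  match s with
  | EVar x => f x
  | EZero => 0
  | EAdd s t => env_eval f s + env_eval f t
  | EScale a s => a *: env_eval f s
  | EOne => one
  | EMul s t => mulA (env_eval f s) (env_eval f t)
  end.

(** For a Lie algebra morphism [f] into [A], this is its extension to an algebra
    morphism [envalg L -> A]; for other [f] it is total but meaningless. *)
Definition env_lift (f : L -> A) (u : envalg) : A := env_eval f (repr u).

Hypothesis mulA_bilinear : is_bilinear mulA.
Hypothesis mulA_assoc : associative mulA.
Hypothesis mulA_1l : left_id one mulA.
Hypothesis mulA_1r : right_id one mulA.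
Variable f : L -> A.
Hypothesis f_linear : linear f.
Hypothesis f_lie : forall x y, f (lie x y) = mulA (f x) (f y) - mulA (f y) (f x).

Let env_evalP s t : env_eqv s t -> env_eval f s = env_eval f t.
Proof.
have B := mulA_bilinear.
have BE := (bilDl B, bilDr B, bilZl B, bilZr B).
elim=> //=.
- by move=> ? ? ? _ -> _ ->.
- by move=> ? ? ? ? _ -> _ ->.
- by move=> ? ? ? _ ->.
- by move=> ? ? ? ? _ -> _ ->.
- by move=> *; rewrite addrA.
- by move=> *; rewrite addrC.
- by move=> *; rewrite add0r.
- by move=> *; rewrite scalerA.
- by move=> *; rewrite scale0r.
- by move=> *; rewrite scale1r.
- by move=> *; rewrite scalerDr.
- by move=> *; rewrite scalerDl.
- by move=> *; rewrite BE.
- by move=> *; rewrite BE.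
- by move=> *; rewrite BE.
- by move=> *; rewrite BE.
- by move=> *; rewrite (linD f_linear).
- by move=> *; rewrite (linZ f_linear).
- by move=> *; rewrite f_lie scaleN1r.
Qed.

Let liftE s : env_lift f (cls s) = env_eval f s.
Proof. exact/env_evalP/env_reprK. Qed.

Lemma env_lift_linear_gen : linear (env_lift f).
Proof.
move=> a; elim/env_clsW=> s; elim/env_clsW=> t.
by rewrite -env_clsZ -env_clsD !liftE.
Qed.

Lemma env_liftM_gen u v : env_lift f (mul u v) = mulA (env_lift f u) (env_lift f v).
Proof. by elim/env_clsW: u => s; elim/env_clsW: v => t; rewrite mulE !liftE. Qed.

Lemma env_lift1_gen : env_lift f env_one = one.
Proof. exact: liftE. Qed.

Lemma env_lift_in_gen x : env_lift f (env_in x) = f x.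
Proof. exact: liftE. Qed.
End Eval.

Let env_one_neq0 : env_one != 0.
Proof.
pose f (x : L) : k^o := 0.
have fL : linear f by move=> a x y; rewrite /f scaler0 addr0.
have fl x y : f (lie x y) = f x * f y - f y * f x by rewrite /f !mulr0 subrr.
have B : is_bilinear (fun x y : k^o => x * y).
  by split=> [? ? ? ?|? ? ? ?] /=; rewrite ?mulrDl ?mulrDr -?scalerAl -?scalerAr.
have := @env_lift1_gen k^o 1 *%R B (@mulrA _) (@mul1r _) (@mulr1 _) f fL fl.
have := lin0 (@env_lift_linear_gen k^o 1 *%R B (@mulrA _) (@mul1r _) (@mulr1 _) f fL fl).
move=> e0 e1; apply/eqP=> e; move: e1; rewrite e e0 => /esym/eqP.
by rewrite oner_eq0.
Qed.

HB.instance Definition _ := GRing.Zmodule_isNzRing.Build envalg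
  env_mulA env_mul1l env_mul1r env_mulDl env_mulDr env_one_neq0.
HB.instance Definition _ := GRing.Lmodule_isLalgebra.Build k envalg
  (fun a x y => esym (env_mulZl a x y)).
HB.instance Definition _ := GRing.Lalgebra_isAlgebra.Build k envalg
  (fun a x y => esym (env_mulZr a x y)).

Lemma env_in_linear : linear env_in.
Proof.
move=> a x y; rewrite /env_in -env_clsZ -env_clsD; apply/env_piP.
apply: EE_trans (EE_varD _ _) _; apply: EE_add; last exact: EE_refl.
exact: EE_varZ.
Qed.

Lemma env_clsM s t : cls (EMul s t) = cls s * cls t.
Proof. by rewrite -mulE. Qed.

Lemma env_in_lie x y :
  env_in (lie x y) = env_in x * env_in y - env_in y * env_in x.
Proof.
rewrite /env_in -scaleN1r -!env_clsM -env_clsZ -env_clsD; apply/env_piP.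
exact: EE_varL.
Qed.

Lemma env_ind (P : envalg -> Prop) :
    (forall x, P (env_in x)) -> P 0 -> P 1 ->
    (forall u v, P u -> P v -> P (u + v)) ->
    (forall a u, P u -> P (a *: u)) ->
    (forall u v, P u -> P v -> P (u * v)) ->
  forall u, P u.
Proof.
move=> Pi P0 P1 PD PZ PM; elim/env_clsW.
elim=> [x||s Ps t Pt|a s Ps||s Ps t Pt].
- exact: Pi.
- exact: P0.
- by rewrite env_clsD; apply: PD.
- by rewrite env_clsZ; apply: PZ.
- exact: P1.
- by rewrite env_clsM; apply: PM.
Qed.

Lemma env_indl (P : envalg -> Prop) :
    P 0 -> P 1 -> (forall u v, P u -> P v -> P (u + v)) ->
    (forall a u, P u -> P (a *: u)) -> (forall x u, P u -> P (env_in x * u)) ->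
  forall u, P u.
Proof.
move=> P0 P1 PD PZ PM u; rewrite -[u]mulr1.
elim/env_ind: u 1 P1 => [x|||u v Pu Pv|a u Pu|u v Pu Pv] w Pw.
- exact: PM.
- by rewrite mul0r.
- by rewrite mul1r.
- by rewrite mulrDl; apply: PD; [apply: Pu|apply: Pv].
- by rewrite -scalerAl; apply: PZ; apply: Pu.
- by rewrite -mulrA; apply: Pu; apply: Pv.
Qed.

Lemma env_ext (A : lmodType k) (f g : envalg -> A) : linear f -> linear g ->
    f 1 = g 1 -> (forall x u, f u = g u -> f (env_in x * u) = g (env_in x * u)) ->
  f =1 g.
Proof.
move=> fL gL fg1 fgM; elim/env_indl=> // [|u v fu fv|a u fu].
- by rewrite (lin0 fL) (lin0 gL).
- by rewrite (linD fL) (linD gL) fu fv.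
- by rewrite (linZ fL) (linZ gL) fu.
Qed.

End EnvDef.

Lemma bracket_aux (Z : zmodType) (a a' b c d d' : Z) :
  a - a' + (d - d') = a + b + (c + d) + (- a' - c + (- b - d')).
Proof.
rewrite [RHS]addrACA (addrACA a b) (addrACA c d).
by rewrite -(addrA (a - a')) (addrA (b - c)) -[c - b]opprB subrr add0r.
Qed.

Section LinearCombinators.
Variable k : fieldType.

Lemma lin_comp (U V W : lmodType k) (f : V -> W) (g : U -> V) :
  linear f -> linear g -> linear (fun u => f (g u)).
Proof. by move=> fL gL a u v /=; rewrite gL fL. Qed.

Lemma bil_comp (U V U' V' W : lmodType k) (F : U' -> V' -> W) f g :
  is_bilinear F -> linear f -> linear g ->
  is_bilinear (fun (u : U) (v : V) => F (f u) (g v)).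
Proof.
move=> FB fL gL; split=> [v|u]; first exact: lin_comp (FB.1 _) fL.
exact: lin_comp (FB.2 _) gL.
Qed.

Lemma bil_post (U V W W' : lmodType k) (h : W -> W') (F : U -> V -> W) :
  linear h -> is_bilinear F -> is_bilinear (fun u v => h (F u v)).
Proof.
move=> hL FB; split=> [v|u]; first exact: lin_comp hL (FB.1 _).
exact: lin_comp hL (FB.2 _).
Qed.

Lemma lin_sum (U V : lmodType k) (f g : U -> V) :
  linear f -> linear g -> linear (fun u => f u + g u).
Proof. by move=> fL gL a u v /=; rewrite fL gL scalerDr addrACA. Qed.

Lemma bil_sum (U V W : lmodType k) (F G : U -> V -> W) :
  is_bilinear F -> is_bilinear G -> is_bilinear (fun u v => F u v + G u v).
Proof.
move=> FB GB; split=> [v|u]; first exact: lin_sum (FB.1 _) (GB.1 _).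
exact: lin_sum (FB.2 _) (GB.2 _).
Qed.

Lemma lin_id (U : lmodType k) : linear (fun u : U => u).
Proof. by []. Qed.

Lemma bil_mul (A : algType k) : is_bilinear (fun x y : A => x * y).
Proof.
by split=> [? ? ? ?|? ? ? ?] /=; rewrite ?mulrDl ?mulrDr -?scalerAl -?scalerAr.
Qed.

Lemma lin_mull (A : algType k) (x : A) : linear (fun y : A => x * y).
Proof. exact: (bil_mul A).2. Qed.

Lemma lin_mulr (A : algType k) (y : A) : linear (fun x : A => x * y).
Proof. exact: (bil_mul A).1. Qed.

Lemma bil_tens (U V : lmodType k) : is_bilinear (fun (u : U) (v : V) => u ⊗ v).
Proof. exact: tens_is_bilinear. Qed.

Lemma tens_lift_comp (U V U' V' W : lmodType k) (F : U' -> V' -> W)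
    (G : U -> V -> tensor U' V') x : is_bilinear F ->
  tens_lift F (tens_lift G x) = tens_lift (fun u v => tens_lift F (G u v)) x.
Proof. by move=> FB; rewrite linear_tens_lift //; apply: tens_lift_linear. Qed.

Lemma bil_lift_l (V W C D U : lmodType k) (F : V -> W -> C -> U)
    (g : D -> tensor V W) :
    (forall c, is_bilinear (fun a b => F a b c)) -> (forall a b, linear (F a b)) ->
    linear g ->
  is_bilinear (fun d c => tens_lift (fun a b => F a b c) (g d)).
Proof.
move=> FB FL gL; split=> [c|d].
  exact: lin_comp (tens_lift_linear (FB c)) gL.
move=> a u v; rewrite -tens_lift_scale -tens_lift_add.
by apply: eq_tens_lift => x y; apply: FL.
Qed.

Lemma bil_lift_r (V W C D U : lmodType k) (F : C -> V -> W -> U)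
    (g : D -> tensor V W) :
    (forall c, is_bilinear (F c)) -> (forall a b, linear (fun c => F c a b)) ->
    linear g ->
  is_bilinear (fun c d => tens_lift (F c) (g d)).
Proof.
move=> FB FL gL; have [l r] := bil_lift_l FB FL gL.
by split.
Qed.

End LinearCombinators.

(** ** The Hopf algebra structure of [envalg L]: the elements of [L] are primitive. *)

Section EnvHopf.
Variables (k : fieldType) (L : lieAlgType k).
Local Notation U := (envalg L).

Definition env_comul : U -> tensor U U :=
  env_lift (1 ⊗ 1) *%R (fun x => env_in x ⊗ 1 + 1 ⊗ env_in x).

Definition env_counit : U -> k := @env_lift k L k^o 1 *%R (fun=> 0).

Definition env_antipode : U -> U :=
  env_lift 1 (fun u v => v * u) (fun x => - env_in x).

Let prim (x : L) : tensor U U := env_in x ⊗ 1 + 1 ⊗ env_in x.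

Let prim_linear : linear prim.
Proof.
move=> a x y; rewrite /prim env_in_linear tensDl tensDr tensZl tensZr.
by rewrite scalerDr addrACA.
Qed.

Let prim_lie x y : prim (lie x y) = prim x * prim y - prim y * prim x.
Proof.
rewrite /prim env_in_lie !(mulrDl, mulrDr) !tensor_mulE !mulr1 !mul1r.
rewrite tensDl tensDr tensNl tensNr !opprD.
exact: bracket_aux.
Qed.

Let T_bil := @tensor_mul_bilinear k U U.

Lemma env_comul_linear : linear env_comul.
Proof.
exact: (env_lift_linear_gen T_bil (@mulrA _) (@mul1r _) (@mulr1 _) prim_linear prim_lie).
Qed.

Lemma env_comulM u v : env_comul (u * v) = env_comul u * env_comul v.
Proof.
exact: (env_liftM_gen T_bil (@mulrA _) (@mul1r _) (@mulr1 _) prim_linear prim_lie).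
Qed.

Lemma env_comul1 : env_comul 1 = 1 ⊗ 1.
Proof.
exact: (env_lift1_gen T_bil (@mulrA _) (@mul1r _) (@mulr1 _) prim_linear prim_lie).
Qed.

Lemma env_comul_in x : env_comul (env_in x) = env_in x ⊗ 1 + 1 ⊗ env_in x.
Proof.
exact: (env_lift_in_gen T_bil (@mulrA _) (@mul1r _) (@mulr1 _) prim_linear prim_lie).
Qed.

Let K_bil : is_bilinear (fun x y : k^o => x * y).
Proof. exact: (bil_mul k^o). Qed.

Let zero_linear : linear (fun _ : L => 0 : k^o).
Proof. by move=> a x y; rewrite scaler0 addr0. Qed.

Let zero_lie (x y : L) : (0 : k^o) = 0 * 0 - 0 * 0.
Proof. by rewrite !mulr0 subrr. Qed.

Lemma env_counit_linear : scalar env_counit.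
Proof.
exact: (env_lift_linear_gen K_bil (@mulrA _) (@mul1r _) (@mulr1 _) zero_linear zero_lie).
Qed.

Lemma env_counitM u v : env_counit (u * v) = env_counit u * env_counit v.
Proof.
exact: (env_liftM_gen K_bil (@mulrA _) (@mul1r _) (@mulr1 _) zero_linear zero_lie).
Qed.

Lemma env_counit1 : env_counit 1 = 1.
Proof.
exact: (env_lift1_gen K_bil (@mulrA _) (@mul1r _) (@mulr1 _) zero_linear zero_lie).
Qed.

Lemma env_counit_in x : env_counit (env_in x) = 0.
Proof.
exact: (env_lift_in_gen K_bil (@mulrA _) (@mul1r _) (@mulr1 _) zero_linear zero_lie).
Qed.

Let opmul (u v : U) := v * u.

Let O_bil : is_bilinear opmul.
Proof. by split; [exact: (bil_mul U).2 | exact: (bil_mul U).1]. Qed.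

Let opmulA : associative opmul.
Proof. by move=> u v w; rewrite /opmul mulrA. Qed.

Let opmul1l : left_id 1 opmul.
Proof. by move=> u; rewrite /opmul mulr1. Qed.

Let opmul1r : right_id 1 opmul.
Proof. by move=> u; rewrite /opmul mul1r. Qed.

Let anti_linear : linear (fun x : L => - env_in x).
Proof. by move=> a x y /=; rewrite env_in_linear opprD scalerN. Qed.

Let anti_lie x y : - env_in (lie x y) =
  opmul (- env_in x) (- env_in y) - opmul (- env_in y) (- env_in x) :> U.
Proof. by rewrite /opmul !mulrNN env_in_lie opprB. Qed.

Lemma env_antipode_linear : linear env_antipode.
Proof. exact: (env_lift_linear_gen O_bil opmulA opmul1l opmul1r anti_linear anti_lie). Qed.

Lemma env_antipodeM u v : env_antipode (u * v) = env_antipode v * env_antipode u.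
Proof. exact: (env_liftM_gen O_bil opmulA opmul1l opmul1r anti_linear anti_lie). Qed.

Lemma env_antipode1 : env_antipode 1 = 1.
Proof. exact: (env_lift1_gen O_bil opmulA opmul1l opmul1r anti_linear anti_lie). Qed.

Lemma env_antipode_in x : env_antipode (env_in x) = - env_in x.
Proof. exact: (env_lift_in_gen O_bil opmulA opmul1l opmul1r anti_linear anti_lie). Qed.

Lemma env_sw1 (W : lmodType k) (F : U -> U -> W) : is_bilinear F ->
  tens_lift F (env_comul 1) = F 1 1.
Proof. by move=> FB; rewrite env_comul1 tens_liftE. Qed.

Lemma env_swM (W : lmodType k) (F : U -> U -> W) x u : is_bilinear F ->
  tens_lift F (env_comul (env_in x * u)) =
  tens_lift (fun a b => F (env_in x * a) b + F a (env_in x * b)) (env_comul u).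
Proof.
move=> FB; rewrite env_comulM env_comul_in.
have B2 : is_bilinear (fun a b => F (env_in x * a) b + F a (env_in x * b)).
  apply: bil_sum.
    exact: bil_comp FB (lin_mull _) (@lin_id _ _).
  exact: bil_comp FB (@lin_id _ _) (lin_mull _).
have FL := tens_lift_linear FB.
apply: (tens_ext (f := fun t => tens_lift F (_ * t)) _ _) (env_comul u).
- by apply: lin_comp => //; exact: T_bil.2.
- exact: tens_lift_linear.
move=> a b; rewrite mulrDl !tensor_mulE !mul1r (linD FL) !tens_liftE //.
Qed.

Let sw_linear (W : lmodType k) (F : U -> U -> W) : is_bilinear F ->
  linear (fun u => tens_lift F (env_comul u)).
Proof.
by move=> FB; apply: lin_comp (tens_lift_linear FB) env_comul_linear.
Qed.

Let U3 := tensor U (tensor U U).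

Let assoc_bil (c : U) : is_bilinear (fun a b : U => a ⊗ (b ⊗ c) : U3).
Proof. exact: bil_comp (bil_tens _ _) (@lin_id _ _) ((bil_tens _ _).1 c). Qed.

Let coassoc1_bil : is_bilinear (fun c d : U =>
  tens_lift (fun a b => a ⊗ (b ⊗ d) : U3) (env_comul c)).
Proof.
apply: (bil_lift_l (F := fun a b d => a ⊗ (b ⊗ d))).
- exact: assoc_bil.
- by move=> a b; apply: lin_comp ((bil_tens _ _).2 a) ((bil_tens _ _).2 b).
- exact: env_comul_linear.
Qed.

Let coassoc2_bil : is_bilinear (fun c d : U => c ⊗ env_comul d : U3).
Proof. exact: bil_comp (bil_tens _ _) (@lin_id _ _) env_comul_linear. Qed.

Let theta (x : L) : U3 -> U3 := tens_lift (fun a t => (env_in x * a) ⊗ t +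
  a ⊗ tens_lift (fun b c => (env_in x * b) ⊗ c + b ⊗ (env_in x * c)) t).

Let theta2_bil x :
  is_bilinear (fun b c : U => (env_in x * b) ⊗ c + b ⊗ (env_in x * c)).
Proof.
apply: bil_sum; first exact: bil_comp (bil_tens _ _) (lin_mull _) (@lin_id _ _).
exact: bil_comp (bil_tens _ _) (@lin_id _ _) (lin_mull _).
Qed.

Let theta_bil x : is_bilinear (fun a t => (env_in x * a) ⊗ t +
  a ⊗ tens_lift (fun b c => (env_in x * b) ⊗ c + b ⊗ (env_in x * c)) t : U3).
Proof.
apply: bil_sum; first exact: bil_comp (bil_tens _ _) (lin_mull _) (@lin_id _ _).
exact: bil_comp (bil_tens _ _) (@lin_id _ _) (tens_lift_linear (theta2_bil x)).
Qed.

Let env_comulA c :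
  tens_lift (fun c1 c2 => tens_lift (fun c11 c12 => c11 ⊗ (c12 ⊗ c2)) (env_comul c1))
      (env_comul c)
  = tens_lift (fun c1 c2 => c1 ⊗ env_comul c2) (env_comul c) :> U3.
Proof.
apply: (@env_ext _ _ _ _ _ (sw_linear coassoc1_bil) (sw_linear coassoc2_bil)) c.
  by rewrite !env_sw1 // env_comul1.
move=> x u IH; rewrite !env_swM //.
have thL : linear (theta x) by exact: tens_lift_linear (theta_bil x).
transitivity (theta x (tens_lift (fun c1 c2 => c1 ⊗ env_comul c2) (env_comul u))).
  rewrite -IH (linear_tens_lift _ _ thL); apply: eq_tens_lift => a b.
  rewrite env_swM // (linear_tens_lift _ _ thL) -tens_lift_add.
  apply: eq_tens_lift => a1 a2; rewrite /theta tens_liftE // tens_liftE //.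
  by rewrite tensDr addrA.
rewrite (linear_tens_lift _ _ thL); apply: eq_tens_lift => a b.
rewrite /theta tens_liftE //; congr (_ + _ ⊗ _).
rewrite env_comulM env_comul_in; symmetry.
apply: (tens_ext (f := fun t => _ * t) _ _) (env_comul b).
- exact: T_bil.2.
- exact: tens_lift_linear.
by move=> c d; rewrite mulrDl !tensor_mulE !mul1r tens_liftE.
Qed.

Let scale_bil : is_bilinear (fun a b : U => env_counit a *: b).
Proof.
split=> [b c x y|a c x y] /=; first by rewrite env_counit_linear scalerDl scalerA.
by rewrite scalerDr !scalerA mulrC.
Qed.

Let scale_bil' : is_bilinear (fun a b : U => env_counit b *: a).
Proof. by split; [exact: scale_bil.2 | exact: scale_bil.1]. Qed.

Let env_counitl c : tens_lift (fun c1 c2 => env_counit c1 *: c2) (env_comul c) = c.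
Proof.
apply: (@env_ext _ _ _ _ _ (sw_linear scale_bil) (@lin_id _ _)) c.
  by rewrite env_sw1 // env_counit1 scale1r.
move=> x u IH; rewrite env_swM // -[in RHS]IH (linear_tens_lift _ _ (lin_mull (env_in x))).
apply: eq_tens_lift => a b.
by rewrite env_counitM env_counit_in mul0r scale0r add0r scalerAr.
Qed.

Let env_counitr c : tens_lift (fun c1 c2 => env_counit c2 *: c1) (env_comul c) = c.
Proof.
apply: (@env_ext _ _ _ _ _ (sw_linear scale_bil') (@lin_id _ _)) c.
  by rewrite env_sw1 // env_counit1 scale1r.
move=> x u IH; rewrite env_swM // -[in RHS]IH (linear_tens_lift _ _ (lin_mull (env_in x))).
apply: eq_tens_lift => a b.
by rewrite env_counitM env_counit_in mul0r scale0r addr0 scalerAr.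
Qed.

HB.instance Definition _ := Lmodule_isCoalgebra.Build k U
  env_comul_linear env_counit_linear env_comulA env_counitl env_counitr.

Let anti_bill : is_bilinear (fun a b : U => env_antipode a * b).
Proof. exact: bil_comp (bil_mul U) env_antipode_linear (@lin_id _ _). Qed.

Let anti_bilr : is_bilinear (fun a b : U => a * env_antipode b).
Proof. exact: bil_comp (bil_mul U) (@lin_id _ _) env_antipode_linear. Qed.

Let counitA_linear : linear (fun u => (env_counit u)%:A : U).
Proof. by move=> a u v; rewrite env_counit_linear scalerDl scalerA. Qed.

Let env_antipodel c :
  tens_lift (fun c1 c2 => env_antipode c1 * c2) (env_comul c) = (env_counit c)%:A.
Proof.
apply: (@env_ext _ _ _ _ _ (sw_linear anti_bill) counitA_linear) c.
  by rewrite env_sw1 // env_counit1 scale1r env_antipode1 mul1r.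
move=> x u IH; rewrite env_swM // env_counitM env_counit_in mul0r scale0r.
rewrite -[RHS](scale0r (tens_lift (fun a b => 1) (env_comul u))) -tens_lift_scale.
apply: eq_tens_lift => a b.
by rewrite env_antipodeM env_antipode_in mulrN mulNr mulrA addNr scale0r.
Qed.

Let env_antipoder c :
  tens_lift (fun c1 c2 => c1 * env_antipode c2) (env_comul c) = (env_counit c)%:A.
Proof.
apply: (@env_ext _ _ _ _ _ (sw_linear anti_bilr) counitA_linear) c.
  by rewrite env_sw1 // env_counit1 scale1r env_antipode1 mul1r.
move=> x u IH; rewrite env_swM // env_counitM env_counit_in mul0r scale0r.
pose T := tens_lift (fun a b : U => a * env_antipode b) (env_comul u).
have rL : linear (fun y : U => - (y * env_in x)).
  by move=> c' y z; rewrite mulrDl opprD -scalerAl scalerN.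
transitivity (env_in x * T - T * env_in x); last first.
  by rewrite /T IH -scalerAl -scalerAr mul1r mulr1 subrr.
rewrite (linear_tens_lift _ _ (lin_mull (env_in x))) (linear_tens_lift _ _ rL).
rewrite -tens_lift_add; apply: eq_tens_lift => a b.
by rewrite env_antipodeM env_antipode_in mulrN mulrN !mulrA.
Qed.

HB.instance Definition _ := Algebra_Coalgebra_isHopf.Build k U
  env_comulM env_comul1 env_counitM env_counit1
  env_antipode_linear env_antipodel env_antipoder.

End EnvHopf.

(** * Irreducible and cocommutative coalgebras *)

Section CoalgebraPredicates.
Variables (k : fieldType) (C : coalgType k).

Definition is_subspace (D : set C) : Prop :=
  D 0 /\ forall (a : k) (x y : C), D x -> D y -> D (a *: x + y).

(** The last clause says that [comul] maps [D] into the image of [D ⊗ D]. *)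
Definition is_subcoalgebra (D : set C) : Prop :=
  is_subspace D /\
  forall c, D c -> exists s : seq (C * C),
    (forall p, p \in s -> D p.1 /\ D p.2) /\ comul c = \sum_(p <- s) p.1 ⊗ p.2.

Definition nonzero_subset (D : set C) : Prop := exists2 x, D x & x != 0.

Definition irreducible_coalg : Prop :=
  forall D E : set C, is_subcoalgebra D -> is_subcoalgebra E ->
    nonzero_subset D -> nonzero_subset E -> nonzero_subset (D `&` E)%classic.

Definition cocommutative_coalg : Prop :=
  forall c : C, (\sw_(c1, c2 <- c) c2 ⊗ c1) = comul c.

End CoalgebraPredicates.

Arguments irreducible_coalg {k} C.
Arguments cocommutative_coalg {k} C.

(** * Crossed modules of Hopf algebras *)

(** A bialgebra morphism between Hopf algebras automatically commutes with the
    antipodes. *)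
Record is_hopf_morphism (k : fieldType) (A B : hopfAlgType k) (f : A -> B) :
    Prop := IsHopfMorphism {
  hm_linear : linear f;
  hm_mul : forall a a', f (a * a') = f a * f a';
  hm_one : f 1 = 1;
  hm_comul : forall a, comul (f a) = \sw_(a1, a2 <- a) f a1 ⊗ f a2;
  hm_counit : forall a, counit (f a) = counit a
}.

Record is_module_action (k : fieldType) (H : algType k) (V : lmodType k)
    (act : H -> V -> V) : Prop := IsModuleAction {
  ma_bilinear : is_bilinear act;
  ma_one : forall v, act 1 v = v;
  ma_mul : forall g h v, act (g * h) v = act g (act h v)
}.

Record is_module_algebra (k : fieldType) (H : hopfAlgType k) (B : algType k)
    (act : H -> B -> B) : Prop := IsModuleAlgebra {
  mal_mul : forall h b b', act h (b * b') = \sw_(h1, h2 <- h) act h1 b * act h2 b';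
  mal_one : forall h, act h 1 = (counit h)%:A
}.

Record is_module_coalgebra (k : fieldType) (H : hopfAlgType k) (B : coalgType k)
    (act : H -> B -> B) : Prop := IsModuleCoalgebra {
  mco_comul : forall h b, comul (act h b) =
    \sw_(h1, h2 <- h) \sw_(b1, b2 <- b) act h1 b1 ⊗ act h2 b2;
  mco_counit : forall h b, counit (act h b) = counit h * counit b
}.

Record hopfXMod (k : fieldType) := HopfXMod {
  hx_src : hopfAlgType k;
  hx_tgt : hopfAlgType k;
  hx_map : hx_src -> hx_tgt;
  hx_act : hx_tgt -> hx_src -> hx_src;
  hx_map_morphism : is_hopf_morphism hx_map;
  hx_act_action : is_module_action hx_act;
  hx_act_algebra : is_module_algebra hx_act;
  hx_act_coalgebra : is_module_coalgebra hx_act;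
  hx_equivariance : forall h b,
    hx_map (hx_act h b) = \sw_(h1, h2 <- h) h1 * hx_map b * antipode h2;
  hx_peiffer : forall b b',
    hx_act (hx_map b) b' = \sw_(b1, b2 <- b) b1 * b' * antipode b2
}.

Record hopfXMod_hom (k : fieldType) (X Y : hopfXMod k) := HopfXModHom {
  hxh_src : hx_src X -> hx_src Y;
  hxh_tgt : hx_tgt X -> hx_tgt Y;
  hxh_src_morphism : is_hopf_morphism hxh_src;
  hxh_tgt_morphism : is_hopf_morphism hxh_tgt;
  hxh_map : forall b, hx_map (hxh_src b) = hxh_tgt (hx_map b);
  hxh_act : forall h b, hxh_src (hx_act h b) = hx_act (hxh_tgt h) (hxh_src b)
}.

Definition hopfXMod_iso (k : fieldType) (X Y : hopfXMod k) : Prop :=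
  exists (f : hopfXMod_hom X Y) (g : hopfXMod_hom Y X),
    [/\ cancel (hxh_src f) (hxh_src g), cancel (hxh_src g) (hxh_src f),
        cancel (hxh_tgt f) (hxh_tgt g) & cancel (hxh_tgt g) (hxh_tgt f)].

(** * Crossed modules of Lie algebras *)

Record lieXMod (k : fieldType) := LieXMod {
  lx_src : lieAlgType k;
  lx_tgt : lieAlgType k;
  lx_map : lx_src -> lx_tgt;
  lx_act : lx_tgt -> lx_src -> lx_src;
  lx_map_linear : linear lx_map;
  lx_map_lie : forall x y, lx_map (lie x y) = lie (lx_map x) (lx_map y);
  lx_act_bilinear : is_bilinear lx_act;
  lx_act_lie : forall n n' m,
    lx_act (lie n n') m = lx_act n (lx_act n' m) - lx_act n' (lx_act n m);
  lx_act_derivation : forall n m m',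
    lx_act n (lie m m') = lie (lx_act n m) m' + lie m (lx_act n m');
  lx_equivariance : forall n m, lx_map (lx_act n m) = lie n (lx_map m);
  lx_peiffer : forall m m', lx_act (lx_map m) m' = lie m m'
}.

(** * The enveloping crossed module of Hopf algebras *)

Section EnvMap.
Variables (k : fieldType) (L L' : lieAlgType k) (f : L -> L').

Definition env_map : envalg L -> envalg L' :=
  env_lift 1 *%R (fun x => env_in (f x)).

Hypothesis f_linear : linear f.
Hypothesis f_lie : forall x y, f (lie x y) = lie (f x) (f y).

Let g_linear : linear (fun x => env_in (f x)).
Proof. exact: lin_comp (@env_in_linear _ _) f_linear. Qed.

Let g_lie x y : env_in (f (lie x y)) =
  env_in (f x) * env_in (f y) - env_in (f y) * env_in (f x).
Proof. by rewrite f_lie env_in_lie. Qed.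

Let B := bil_mul (envalg L').

Lemma env_map_linear : linear env_map.
Proof. exact: (env_lift_linear_gen B (@mulrA _) (@mul1r _) (@mulr1 _) g_linear g_lie). Qed.

Lemma env_mapM u v : env_map (u * v) = env_map u * env_map v.
Proof. exact: (env_liftM_gen B (@mulrA _) (@mul1r _) (@mulr1 _) g_linear g_lie). Qed.

Lemma env_map1 : env_map 1 = 1.
Proof. exact: (env_lift1_gen B (@mulrA _) (@mul1r _) (@mulr1 _) g_linear g_lie). Qed.

Lemma env_map_in x : env_map (env_in x) = env_in (f x).
Proof. exact: (env_lift_in_gen B (@mulrA _) (@mul1r _) (@mulr1 _) g_linear g_lie). Qed.

Lemma env_map_hopf : is_hopf_morphism env_map.
Proof.
have MB : is_bilinear (fun a b => env_map a ⊗ env_map b).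
  exact: bil_comp (bil_tens _ _) env_map_linear env_map_linear.
have sL : linear (fun u => \sw_(a, b <- u) env_map a ⊗ env_map b).
  exact: lin_comp (tens_lift_linear MB) comul_linear.
split; [exact: env_map_linear | exact: env_mapM | exact: env_map1 | move=> u | move=> u].
  apply: (@env_ext _ _ _ _ _ (lin_comp comul_linear env_map_linear) sL) u.
    by rewrite env_map1 [LHS]comul1 [in RHS]comul1 tens_liftE // env_map1.
  move=> x u IH; rewrite [in RHS]env_swM // env_mapM comulM IH env_map_in.
  rewrite [comul (env_in _)]env_comul_in.
  rewrite (linear_tens_lift _ _ ((@tensor_mul_bilinear _ _ _).2 _)).
  apply: eq_tens_lift => a b.
  by rewrite mulrDl !tensor_mulE !mul1r !env_mapM env_map_in.
have cL : linear (counit : envalg L -> k^o) by exact: counit_linear.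
have cL' : linear (fun u => counit (env_map u) : k^o).
  exact: (@lin_comp k _ _ k^o _ _ (@counit_linear _ _) env_map_linear).
apply: (@env_ext _ _ k^o _ _ cL' cL) u => [|x u IH].
  by rewrite env_map1 [LHS]counit1 [RHS]counit1.
rewrite env_mapM counitM [RHS]counitM env_map_in.
by rewrite ![counit (env_in _)]env_counit_in !mul0r.
Qed.
End EnvMap.

(** Extension of a derivation [d] of [L] to a derivation of [envalg L], obtained
    from the algebra morphism [u |-> u + ε D u] into the dual numbers
    [(envalg L)[ε]], pairs [(u, v)] standing for [u + ε v]. *)
Section EnvDer.
Variables (k : fieldType) (L : lieAlgType k) (d : L -> L).
Local Notation U := (envalg L).
Local Notation DU := (U * U)%type.

Definition dual_mul (p q : DU) : DU := (p.1 * q.1, p.1 * q.2 + p.2 * q.1).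

Definition env_der (u : U) : U :=
  (@env_lift k L DU (1, 0) dual_mul (fun x => (env_in x, env_in (d x))) u).2.

Hypothesis d_linear : linear d.
Hypothesis d_der : forall x y, d (lie x y) = lie (d x) y + lie x (d y).

Let f (x : L) : DU := (env_in x, env_in (d x)).

Let dual_eq (p q : DU) : p.1 = q.1 -> p.2 = q.2 -> p = q.
Proof. by case: p q => [? ?] [? ?] /= -> ->. Qed.

Let dual_bil : is_bilinear dual_mul.
Proof.
split=> [p a q r|p a q r]; apply: dual_eq => /=.
- exact: (bil_mul U).1.
- by rewrite !mulrDl -!scalerAl scalerDr addrACA.
- exact: (bil_mul U).2.
- by rewrite !mulrDr -!scalerAr scalerDr addrACA.
Qed.

Let dualA : associative dual_mul.
Proof.
move=> p q r; apply: dual_eq => /=; first exact: mulrA.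
by rewrite mulrDr mulrDl !mulrA addrA.
Qed.

Let dual1l : left_id (1, 0) dual_mul.
Proof. by move=> p; apply: dual_eq; rewrite /= ?mul1r // mul0r addr0. Qed.

Let dual1r : right_id (1, 0) dual_mul.
Proof. by move=> p; apply: dual_eq; rewrite /= ?mulr1 // mulr0 add0r. Qed.

Let f_linear : linear f.
Proof.
move=> a x y; apply: dual_eq => /=; first exact: env_in_linear.
by rewrite d_linear env_in_linear.
Qed.

Let f_lie x y : f (lie x y) = dual_mul (f x) (f y) - dual_mul (f y) (f x).
Proof.
apply: dual_eq => /=; first exact: env_in_lie.
rewrite d_der (linD (@env_in_linear _ _)) !env_in_lie.
by rewrite [X in _ = X - _]addrC [X in _ = _ - X]addrC opprD addrACA
  [X in _ = _ + X]addrC -addrACA.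
Qed.

Let F := env_lift (1, 0) dual_mul f.

Let FL : linear F.
Proof. exact: (env_lift_linear_gen dual_bil dualA dual1l dual1r f_linear f_lie). Qed.

Let FM u v : F (u * v) = dual_mul (F u) (F v).
Proof. exact: (env_liftM_gen dual_bil dualA dual1l dual1r f_linear f_lie). Qed.

Let F1 : F 1 = (1, 0).
Proof. exact: (env_lift1_gen dual_bil dualA dual1l dual1r f_linear f_lie). Qed.

Let Fin x : F (env_in x) = f x.
Proof. exact: (env_lift_in_gen dual_bil dualA dual1l dual1r f_linear f_lie). Qed.

Let F_fst u : (F u).1 = u.
Proof.
elim/env_indl: u => [||u v Hu Hv|a u Hu|x u Hu].
- by rewrite (lin0 FL).
- by rewrite F1.
- by rewrite (linD FL) /= Hu Hv.
- by rewrite (linZ FL) /= Hu.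
- by rewrite FM Fin /= Hu.
Qed.

Lemma env_der_linear : linear env_der.
Proof. by move=> a u v; rewrite /env_der -/f -/F FL. Qed.

Lemma env_derM u v : env_der (u * v) = env_der u * v + u * env_der v.
Proof. by rewrite /env_der -/f -/F FM /= !F_fst addrC. Qed.

Lemma env_der1 : env_der 1 = 0.
Proof. by rewrite /env_der -/f -/F F1. Qed.

Lemma env_der_in x : env_der (env_in x) = env_in (d x).
Proof. by rewrite /env_der -/f -/F Fin. Qed.

Lemma env_der_comul u : comul (env_der u) =
  \sw_(a, b <- u) (env_der a ⊗ b + a ⊗ env_der b).
Proof.
have DL := env_der_linear.
have B : is_bilinear (fun a b => env_der a ⊗ b + a ⊗ env_der b).
  apply: bil_sum; first exact: bil_comp (bil_tens _ _) DL (@lin_id _ _).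
  exact: bil_comp (bil_tens _ _) (@lin_id _ _) DL.
apply: (@env_ext _ _ _ _ _ (lin_comp comul_linear DL)
  (lin_comp (tens_lift_linear B) comul_linear)) u.
  rewrite env_der1 (lin0 comul_linear) comul1 tens_liftE //.
  by rewrite env_der1 tens0l tens0r addr0.
move=> x u IH; rewrite [in RHS]env_swM //.
rewrite env_derM env_der_in (linD comul_linear) !comulM IH.
rewrite ![comul (env_in _)]env_comul_in.
have T2 t := (@tensor_mul_bilinear k U U).2 t.
rewrite (linear_tens_lift _ _ (T2 _)).
transitivity (tens_lift (fun a b => (env_in (d x) ⊗ 1 + 1 ⊗ env_in (d x)) * (a ⊗ b)) (comul u)
  + tens_lift (fun a b => (env_in x ⊗ 1 + 1 ⊗ env_in x) * (env_der a ⊗ b + a ⊗ env_der b)) (comul u)).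
  congr (_ + _); rewrite -(linear_tens_lift _ _ (T2 _)); congr (_ * _).
  have tL := tens_lift_linear (bil_tens U U).
  apply: (tens_ext (@lin_id _ _) tL) => a b.
  by rewrite tens_liftE //; apply: bil_tens.
rewrite -tens_lift_add; apply: eq_tens_lift => a b.
rewrite !(mulrDl, mulrDr) !tensor_mulE !mul1r !env_derM env_der_in tensDl tensDr.
by rewrite [LHS](AC (2*(2*2)) ((1*3)*4*(5*(2*6)))).
Qed.

Lemma env_der_counit u : counit (env_der u) = 0.
Proof.
have cL : linear (fun u => counit (env_der u) : k^o).
  exact: (@lin_comp k _ _ k^o _ _ (@counit_linear _ _) env_der_linear).
have zL : linear (fun _ : U => 0 : k^o) by move=> ? ? ?; rewrite scaler0 addr0.
apply: (@env_ext _ _ k^o _ _ cL zL) u => [|x u IH].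
  by rewrite env_der1 (lin0 (U:=U) (V:=k^o) (@counit_linear _ _)).
rewrite env_derM (linD (V := k^o) (@counit_linear _ _)) !counitM IH mulr0 addr0.
by rewrite env_der_in [counit (env_in _)]env_counit_in mul0r.
Qed.

End EnvDer.

Section EnvAct.
Variables (k : fieldType) (N M : lieAlgType k) (act : N -> M -> M).

(** Letting [x \in N] act by the derivation of [envalg M] extending [act x], an
    element of [envalg N] acts through composites of these derivations. *)
Fixpoint env_act_eval (s : env_term N) : envalg M -> envalg M :=
  match s with
  | EVar x => env_der (act x)
  | EZero => fun=> 0
  | EAdd s t => fun b => env_act_eval s b + env_act_eval t b
  | EScale a s => fun b => a *: env_act_eval s b
  | EOne => fun b => b
  | EMul s t => fun b => env_act_eval s (env_act_eval t b)
  end.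

Definition env_act (h : envalg N) (b : envalg M) : envalg M :=
  env_act_eval (repr h) b.

Hypothesis act_bilinear : is_bilinear act.
Hypothesis act_lie : forall n n' m,
  act (lie n n') m = act n (act n' m) - act n' (act n m).
Hypothesis act_der : forall n m m',
  act n (lie m m') = lie (act n m) m' + lie m (act n m').

Let DL x := env_der_linear (act_bilinear.2 x) (act_der x).
Let DM x := env_derM (act_bilinear.2 x) (act_der x).
Let D1 x := env_der1 (act_bilinear.2 x) (act_der x).
Let Din x := env_der_in (act_bilinear.2 x) (act_der x).

Let eval_linear s : linear (env_act_eval s).
Proof.
elim: s => [x||s IHs t IHt|a s IHs||s IHs t IHt] c u v /=.
- exact: DL.
- by rewrite scaler0 addr0.
- by rewrite IHs IHt scalerDr addrACA.
- by rewrite IHs scalerDr !scalerA mulrC.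
- by [].
- by rewrite IHt IHs.
Qed.

Let der_add x y b : env_der (act (x + y)) b = env_der (act x) b + env_der (act y) b.
Proof.
apply: (@env_ext _ _ _ _ _ (DL _) (lin_sum (DL x) (DL y))) b.
  by rewrite !D1 addr0.
move=> z b IH; rewrite !DM IH !Din (bilDl act_bilinear).
by rewrite (linD (@env_in_linear _ _)) mulrDl mulrDr addrACA.
Qed.

Let der_scale a x b : env_der (act (a *: x)) b = a *: env_der (act x) b.
Proof.
have ZL : linear (fun b => a *: env_der (act x) b).
  by move=> c u v; rewrite DL scalerDr !scalerA mulrC.
apply: (@env_ext _ _ _ _ _ (DL _) ZL) b; first by rewrite !D1 scaler0.
move=> z b IH; rewrite !DM IH !Din (bilZl act_bilinear).
by rewrite (linZ (@env_in_linear _ _)) scalerDr scalerAl scalerAr.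
Qed.

Let der_lie x y b : env_der (act (lie x y)) b =
  env_der (act x) (env_der (act y) b) + -1 *: env_der (act y) (env_der (act x) b).
Proof.
have NL : linear (fun b => -1 *: env_der (act y) (env_der (act x) b)).
  by move=> c u v; rewrite !DL scalerDr !scalerA mulrC.
apply: (@env_ext _ _ _ _ _ (DL _) (lin_sum (lin_comp (DL x) (DL y)) NL)) b.
  by rewrite !D1 !(lin0 (DL _)) scaler0 addr0.
move=> z b IH; rewrite !DM IH !(linD (DL _)) !DM !Din act_lie.
rewrite (linD (@env_in_linear _ _)) (linN (@env_in_linear _ _)) !scaleN1r.
rewrite mulrDl mulrDr mulNr mulrN !opprD.
exact: bracket_aux.
Qed.

Let evalP s t : env_eqv s t -> env_act_eval s =1 env_act_eval t.
Proof.
elim=> //=.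
- by move=> {}s {}t _ e b.
- by move=> ? ? ? _ e1 _ e2 b; rewrite e1.
- by move=> ? ? ? ? _ e1 _ e2 b; rewrite e1 e2.
- by move=> ? ? ? _ e1 b; rewrite e1.
- by move=> ? ? ? ? _ e1 _ e2 b; rewrite e1 e2.
- by move=> * ? /=; rewrite addrA.
- by move=> * ? /=; rewrite addrC.
- by move=> * ? /=; rewrite add0r.
- by move=> * ? /=; rewrite scalerA.
- by move=> * ? /=; rewrite scale0r.
- by move=> * ? /=; rewrite scale1r.
- by move=> * ? /=; rewrite scalerDr.
- by move=> * ? /=; rewrite scalerDl.
- by move=> * ? /=; rewrite (linD (@eval_linear _)).
- by move=> * ? /=; rewrite (linZ (@eval_linear _)).
Qed.

Let actE s b : env_act (env_cls s) b = env_act_eval s b.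
Proof. exact/evalP/env_reprK. Qed.

Lemma env_act_in x b : env_act (env_in x) b = env_der (act x) b.
Proof. exact: actE. Qed.

Lemma env_act1 b : env_act 1 b = b.
Proof. exact: actE. Qed.

Lemma env_actM g h b : env_act (g * h) b = env_act g (env_act h b).
Proof.
elim/env_clsW: g => s; elim/env_clsW: h => t.
by rewrite -env_clsM !actE.
Qed.

Lemma env_act_bilinear : is_bilinear env_act.
Proof.
split=> [b a g h|h a b b']; last exact: eval_linear.
elim/env_clsW: g => s; elim/env_clsW: h => t.
by rewrite -env_clsZ -env_clsD !actE.
Qed.

Lemma env_act_action : is_module_action env_act.
Proof. by split; [exact: env_act_bilinear | exact: env_act1 | exact: env_actM]. Qed.

Let AL b : linear (fun h => env_act h b). Proof. exact: env_act_bilinear.1. Qed.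
Let AR h : linear (env_act h). Proof. exact: env_act_bilinear.2. Qed.

Let sw_linear (L : lieAlgType k) (W : lmodType k) (F : envalg L -> envalg L -> W) :
  is_bilinear F -> linear (fun u => tens_lift F (comul u)).
Proof. by move=> FB; apply: lin_comp (tens_lift_linear FB) comul_linear. Qed.

Lemma env_act_algebra : is_module_algebra env_act.
Proof.
split=> [h b b'|h].
  have B : is_bilinear (fun h1 h2 => env_act h1 b * env_act h2 b').
    exact: bil_comp (bil_mul _) (AL b) (AL b').
  apply: (@env_ext _ _ _ _ _ (AL (b * b')) (sw_linear B)) h.
    by rewrite comul1 tens_liftE // !env_act1.
  move=> x h IH; rewrite [in RHS]env_swM // env_actM IH env_act_in.
  rewrite (linear_tens_lift _ _ (DL x)); apply: eq_tens_lift => h1 h2.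
  by rewrite DM !env_actM !env_act_in.
have L : linear (fun h : envalg N => (counit h)%:A : envalg M).
  by move=> a u v; rewrite counit_linear scalerDl scalerA.
apply: (@env_ext _ _ _ _ _ (AL 1) L) h; first by rewrite env_act1 counit1 scale1r.
move=> x h IH; rewrite env_actM IH env_act_in (linZ (DL _)) D1 scaler0.
by rewrite counitM [counit (env_in _)]env_counit_in mul0r scale0r.
Qed.

Lemma env_act_coalgebra : is_module_coalgebra env_act.
Proof.
split=> h b.
  have B1 h1 h2 : is_bilinear (fun b1 b2 => env_act h1 b1 ⊗ env_act h2 b2).
    exact: bil_comp (bil_tens _ _) (AR h1) (AR h2).
  have B : is_bilinear (fun h1 h2 => \sw_(b1, b2 <- b) env_act h1 b1 ⊗ env_act h2 b2).
    apply: tens_lift_bilinear => b1 b2.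
    exact: bil_comp (bil_tens _ _) (AL b1) (AL b2).
  apply: (@env_ext _ _ _ _ _ (lin_comp comul_linear (AL b)) (sw_linear B)) h.
    rewrite env_act1 comul1 tens_liftE //.
    under eq_tens_lift => b1 b2 do rewrite !env_act1.
    have tL := tens_lift_linear (bil_tens (envalg M) (envalg M)).
    apply: (tens_ext (@lin_id _ _) tL) => b1 b2.
    by rewrite tens_liftE //; apply: bil_tens.
  move=> x h IH; rewrite [in RHS]env_swM // env_actM env_act_in.
  rewrite (env_der_comul (act_bilinear.2 x) (act_der x)) IH.
  have C : is_bilinear (fun a b => env_der (act x) a ⊗ b + a ⊗ env_der (act x) b).
    apply: bil_sum; first exact: bil_comp (bil_tens _ _) (DL x) (@lin_id _ _).
    exact: bil_comp (bil_tens _ _) (@lin_id _ _) (DL x).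
  rewrite (linear_tens_lift _ _ (tens_lift_linear C)); apply: eq_tens_lift => h1 h2.
  rewrite (linear_tens_lift _ _ (tens_lift_linear C)) -tens_lift_add.
  apply: eq_tens_lift => b1 b2; rewrite tens_liftE // !env_actM !env_act_in //.
have L : linear (fun h => counit (env_act h b) : k^o).
  exact: (@lin_comp k _ _ k^o _ _ (@counit_linear _ _) (AL b)).
have L' : linear (fun h : envalg N => counit h * counit b : k^o).
  by move=> a u v; rewrite counit_linear mulrDl -mulrA.
apply: (@env_ext _ _ k^o _ _ L L') h; first by rewrite env_act1 counit1 mul1r.
move=> x h IH; rewrite env_actM env_act_in.
rewrite (env_der_counit (act_bilinear.2 x) (act_der x)) counitM.
by rewrite [counit (env_in _)]env_counit_in !mul0r.
Qed.

End EnvAct.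

Section EnvXMod.
Variables (k : fieldType) (X : lieXMod k).
Local Notation M := (lx_src X).
Local Notation N := (lx_tgt X).
Local Notation mu := (@lx_map k X).
Local Notation act := (@lx_act k X).
Local Notation U_mu := (env_map mu).
Local Notation U_act := (env_act act).

Let actL x : linear (act x). Proof. exact: (lx_act_bilinear X).2. Qed.
Let actD x := @lx_act_derivation k X x.
Let DL x := env_der_linear (actL x) (actD x).
Let DM x := env_derM (actL x) (actD x).
Let D1 x := env_der1 (actL x) (actD x).
Let Din x := env_der_in (actL x) (actD x).

Let mL : linear U_mu.
Proof. exact: env_map_linear (@lx_map_linear k X) (@lx_map_lie k X). Qed.
Let mM u v : U_mu (u * v) = U_mu u * U_mu v.
Proof. exact: env_mapM (@lx_map_linear k X) (@lx_map_lie k X) _ _. Qed.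
Let m1 : U_mu 1 = 1.
Proof. exact: env_map1 (@lx_map_linear k X) (@lx_map_lie k X). Qed.
Let min x : U_mu (env_in x) = env_in (mu x).
Proof. exact: env_map_in (@lx_map_linear k X) (@lx_map_lie k X) _. Qed.

Let aB : is_bilinear U_act.
Proof. exact: env_act_bilinear (lx_act_bilinear X) (@lx_act_lie k X) actD. Qed.
Let a1 b : U_act 1 b = b.
Proof. exact: env_act1 (lx_act_bilinear X) (@lx_act_lie k X) actD _. Qed.
Let aM g h b : U_act (g * h) b = U_act g (U_act h b).
Proof. exact: env_actM (lx_act_bilinear X) (@lx_act_lie k X) actD _ _ _. Qed.
Let ain x b : U_act (env_in x) b = env_der (act x) b.
Proof. exact: env_act_in (lx_act_bilinear X) (@lx_act_lie k X) actD _ _. Qed.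

Let sw_linear (L : lieAlgType k) (W : lmodType k) (F : envalg L -> envalg L -> W) :
  is_bilinear F -> linear (fun u => tens_lift F (comul u)).
Proof. by move=> FB; apply: lin_comp (tens_lift_linear FB) comul_linear. Qed.

Let lin_comm (L : lieAlgType k) (x : envalg L) : linear (fun c => x * c - c * x).
Proof.
by move=> a u v; rewrite mulrDr mulrDl -scalerAr -scalerAl opprD scalerBr addrACA.
Qed.

Let comm_mul (R : nzRingType) (x y c : R) :
  x * (y * c) - y * c * x = (x * y - y * x) * c + y * (x * c - c * x).
Proof. by rewrite mulrBl mulrBr !mulrA addrA subrK. Qed.

Let equivariance_in x c :
  U_mu (env_der (act x) c) = env_in x * U_mu c - U_mu c * env_in x.
Proof.
apply: (@env_ext _ _ _ _ _ (lin_comp mL (DL x)) (lin_comp (lin_comm (env_in x)) mL)) c.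
  by rewrite D1 (lin0 mL) m1 mulr1 mul1r subrr.
move=> y c IH; rewrite DM (linD mL) !mM IH Din !min lx_equivariance.
by rewrite comm_mul env_in_lie.
Qed.

Let peiffer_in y c :
  env_der (act (mu y)) c = env_in y * c - c * env_in y.
Proof.
apply: (@env_ext _ _ _ _ _ (DL _) (lin_comm (env_in y))) c.
  by rewrite D1 mulr1 mul1r subrr.
move=> z c IH; rewrite DM IH Din lx_peiffer.
by rewrite comm_mul env_in_lie.
Qed.

Let conj_bil (L L' : lieAlgType k) (f : envalg L -> envalg L') (c : envalg L') :
  linear f -> is_bilinear (fun a b => f a * c * antipode (f b)).
Proof.
move=> fL; apply: (bil_comp (F := fun a b => a * b)); first exact: bil_mul.
  exact: lin_comp (lin_mulr c) fL.
exact: lin_comp antipode_linear fL.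
Qed.

Let U_equivariance h b :
  U_mu (U_act h b) = \sw_(h1, h2 <- h) h1 * U_mu b * antipode h2.
Proof.
have B := conj_bil (U_mu b) (@lin_id k (envalg N)).
apply: (@env_ext _ _ _ _ _ (lin_comp mL (aB.1 b)) (sw_linear B)) h.
  by rewrite a1 comul1 tens_liftE // mul1r [antipode _]env_antipode1 mulr1.
move=> x h IH; rewrite [in RHS]env_swM // aM ain equivariance_in IH.
rewrite (linear_tens_lift _ _ (lin_comm (env_in x))).
apply: eq_tens_lift => h1 h2.
rewrite [antipode (_ * _)]env_antipodeM env_antipode_in mulrN.
by rewrite !mulrN !mulrA.
Qed.

Let U_peiffer b b' :
  U_act (U_mu b) b' = \sw_(b1, b2 <- b) b1 * b' * antipode b2.
Proof.
have B := conj_bil b' (@lin_id k (envalg M)).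
apply: (@env_ext _ _ _ _ _ (lin_comp (aB.1 b') mL) (sw_linear B)) b.
  by rewrite m1 a1 comul1 tens_liftE // mul1r [antipode _]env_antipode1 mulr1.
move=> y b IH; rewrite [in RHS]env_swM // mM min aM ain peiffer_in IH.
rewrite (linear_tens_lift _ _ (lin_comm (env_in y))).
apply: eq_tens_lift => b1 b2.
by rewrite [antipode (_ * _)]env_antipodeM env_antipode_in !mulrN !mulrA.
Qed.

Definition env_xmod : hopfXMod k := HopfXMod
  (env_map_hopf (@lx_map_linear k X) (@lx_map_lie k X))
  (env_act_action (lx_act_bilinear X) (@lx_act_lie k X) actD)
  (env_act_algebra (lx_act_bilinear X) (@lx_act_lie k X) actD)
  (env_act_coalgebra (lx_act_bilinear X) (@lx_act_lie k X) actD)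
  U_equivariance U_peiffer.

End EnvXMod.

(* Main.v *)
Require Import Defs.
From HB Require Import structures.
From mathcomp Require Import all_boot all_order all_algebra.
From mathcomp Require Import boolp classical_sets.

Set Implicit Arguments.
Unset Strict Implicit.
Unset Printing Implicit Defensive.

Import GRing.Theory.
Local Open Scope ring_scope.

(** A Hopf algebra [H] of the kind considered here is the enveloping algebra of
    the Lie algebra [P(H)] of its primitive elements (the theorem of Cartier,
    Milnor and Moore). Since the canonical map [env_prim : U(P(H)) -> H] commutes
    with everything in sight, taking primitive elements of a crossed module
    [B -> H] yields a crossed module of Lie algebras [P(B) -> P(H)], and the two
    maps [env_prim] form the required isomorphism. The work is in the bijectivity
    of [env_prim].

    Conilpotency. By cocommutativity a subspace of [H] stable under the
    contractions [h |-> \sum f(h_2) h_1], [f] a functional, is a subcoalgebra, so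
    by irreducibility it contains [1] unless it is zero. Contraction with a functional
    [f] such that [f 1 = 0] kills [1], hence shrinks every nonzero finite-dimensional stable
    subspace. As each [h] lies in such a subspace, long products of these
    contractions annihilate [h] ([fil_exhaustive]), and so the convolution powers
    of the projection [aug] onto the augmentation ideal vanish on [h] from some
    rank on ([cpow_fil]).

    Eulerian components. By the binomial formula the convolution power
    [id^{*n}] applied to [h] is then a polynomial in [n], with coefficients
    [euler m h], the values of [(log id)^{*m} / m!]. Comparing coefficients in
    the identities satisfied by all [id^{*n}] gives what is needed: [euler 1 h]
    is primitive because [id^{*n}] is a coalgebra map ([euler1_primitive]), and
    [id^{*2n} = id^{*n} * id^{*n}] expresses [(2^m - 2) euler m h] by components
    of lower index, so that [H] is generated by its primitive elements
    ([primitively_generated]) and [env_prim] is surjective.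

    Injectivity. In characteristic 0 polarization shows that an enveloping
    algebra is spanned by the powers of elements of the Lie algebra
    ([env_power_ind]). The map [log_env : H -> U(P(H))] induced by [euler 1] sees
    only the first power of a primitive element, so its convolution exponential
    sends [x^n] in [H] back to [x^n] in [U(P(H))] and is a left inverse of
    [env_prim] ([exp_log_env]). *)

(** * Linear algebra *)

Section LinearAlgebra.
Variable k : fieldType.

Definition subspace (V : lmodType k) (S : set V) : Prop :=
  S 0 /\ forall (a : k) (x y : V), S x -> S y -> S (a *: x + y).

Section Subspace.
Variables (V : lmodType k) (S : set V).
Hypothesis subS : subspace S.

Lemma subspaceD x y : S x -> S y -> S (x + y).
Proof. by move=> Sx Sy; rewrite -[x]scale1r; apply: subS.2. Qed.

Lemma subspaceZ a x : S x -> S (a *: x).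
Proof. by move=> Sx; rewrite -[_ *: _]addr0; apply: subS.2 => //; exact: subS.1. Qed.

Lemma subspaceN x : S x -> S (- x).
Proof. by rewrite -scaleN1r; exact: subspaceZ. Qed.

Lemma subspaceB x y : S x -> S y -> S (x - y).
Proof. by move=> Sx Sy; apply: subspaceD => //; apply: subspaceN. Qed.

Lemma subspace_sum (I : Type) (r : seq I) (P : pred I) (F : I -> V) :
  (forall i, P i -> S (F i)) -> S (\sum_(i <- r | P i) F i).
Proof. by move=> SF; apply: big_ind => //; [exact: subS.1 | exact: subspaceD]. Qed.

Lemma subspace_scaleI a x : a != 0 -> S (a *: x) -> S x.
Proof. by move=> a0 /(subspaceZ a^-1); rewrite scalerA mulVf // scale1r. Qed.

Lemma subspace_tens_lift (U W : lmodType k) (F : U -> W -> V) t :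
  (forall u w, S (F u w)) -> S (tens_lift F t).
Proof.
move=> SF; rewrite /tens_lift; elim: (repr t) => //= [||a s].
- exact: subS.1.
- by move=> s Ss s' Ss'; apply: subspaceD.
- exact: subspaceZ.
Qed.

End Subspace.

Lemma subspace0 (V : lmodType k) : subspace (fun x : V => x = 0).
Proof. by split=> // a x y -> ->; rewrite scaler0 addr0. Qed.

Lemma subspace_preim (V W : lmodType k) (f : V -> W) (S : set W) :
  linear f -> subspace S -> subspace (fun x => S (f x)).
Proof.
move=> fL subS; split=> [|a x y Sx Sy]; first by rewrite (lin0 fL); exact: subS.1.
by rewrite fL; apply: subS.2.
Qed.

Lemma subspace_image (V W : lmodType k) (f : V -> W) :
  linear f -> subspace (fun y => exists x, y = f x).
Proof.
move=> fL; split=> [|a _ _ [x ->] [y ->]]; first by exists 0; rewrite (lin0 fL).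
by exists (a *: x + y); rewrite fL.
Qed.

Lemma lin_bigsum (V W : lmodType k) (f : V -> W) (I : Type) (r : seq I)
    (P : pred I) (F : I -> V) : linear f ->
  f (\sum_(i <- r | P i) F i) = \sum_(i <- r | P i) f (F i).
Proof. by move=> fL; apply: (big_morph f (linD fL) (lin0 fL)). Qed.

(** Among the subspaces containing [W] but not [v], Zorn's lemma gives a maximal
    one [M]; then [V] is the direct sum of [M] and the line through [v], and the
    coordinate along [v] is the functional. *)
Lemma separating_functional (V : lmodType k) (W : set V) v :
    subspace W -> ~ W v ->
  exists f : V -> k^o, [/\ linear f, f v = 1 & forall w, W w -> f w = 0].
Proof.
move=> subW Wv.
(* The empty set is admitted so that the union of the empty chain qualifies. *)
pose P (X : set V) := X = set0 \/ [/\ subspace X, W `<=` X & ~ X v]%classic.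
have chainP (F : set (set V)) : (F `<=` P -> total_on F subset ->
    P (\bigcup_(X in F) X))%classic.
  move=> FP tF.
  have [[Y [FY Y0]]|noY] := pselect (exists Y, F Y /\ Y <> set0); last first.
    left; apply/seteqP; split=> // x [Y FY Yx].
    by apply: noY; exists Y; split=> // Y0; rewrite Y0 in Yx.
  have [//|[subY WY Yv]] := FP _ FY.
  right; split.
  - split=> [|a x y [X FX Xx] [Z FZ Zy]]; first by exists Y => //; exact: subY.1.
    have good X' x' : F X' -> X' x' -> subspace X'.
      by move=> FX' Xx'; have [e|[]//] := FP _ FX'; rewrite e in Xx'.
    have [XZ|ZX] := tF _ _ FX FZ.
      by exists Z => //; apply: (good _ _ FZ Zy).2 => //; apply: XZ.
    by exists X => //; apply: (good _ _ FX Xx).2 => //; apply: ZX.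
  - by move=> x Wx; exists Y => //; apply: WY.
  - move=> [X FX Xv]; have [e|[_ _ nXv]] := FP _ FX; last exact: nXv.
    by rewrite e in Xv.
have [M [PM maxM]] := Zorn_bigcup chainP.
have [subM WM Mv] : [/\ subspace M, W `<=` M & ~ M v]%classic.
  case: PM => // M0; case: (maxM W); last by right; split.
  by rewrite M0; split=> // /(_ 0 subW.1).
have coord u : exists c, M (u - c *: v).
  have [Mu|Mu] := pselect (M u); first by exists 0; rewrite scale0r subr0.
  pose M' x := exists c, M (x - c *: u).
  have [[c Mc]|nM'v] := pselect (M' v).
    have c0 : c != 0.
      by apply/eqP => c0; move: Mc; rewrite c0 scale0r subr0.
    exists c^-1; apply: (subspace_scaleI subM (a := - c)); first by rewrite oppr_eq0.
    by rewrite scaleNr scalerBr scalerA divff // scale1r opprB.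
  case: (maxM M'); last first.
    right; split=> //.
      split=> [|a x y [c Mx] [d My]].
        by exists 0; rewrite scale0r subr0; exact: subM.1.
      exists (a * c + d); rewrite scalerDl opprD addrACA -scalerA -scalerBr.
      exact: subM.2.
    by move=> x /WM Mx; exists 0; rewrite scale0r subr0.
  split=> [x Mx|M'M]; first by exists 0; rewrite scale0r subr0.
  by apply/Mu/M'M; exists 1; rewrite scale1r subrr; exact: subM.1.
have [f Mf] := choice coord; exists f.
have uniq_coord u c d : M (u - c *: v) -> M (u - d *: v) -> c = d.
  move=> Mc Md; apply/eqP; rewrite -subr_eq0; apply/negPn/negP => cd0.
  apply: Mv; apply: (subspace_scaleI subM cd0).
  have := subspaceB subM Md Mc.
  by rewrite scalerBl opprB addrC addrA addrNK; congr M; rewrite addrC.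
split.
- move=> a x y; apply: (uniq_coord (a *: x + y)) => //.
  rewrite scalerDl opprD addrACA -[a *: (f x : k^o)]/(a * f x) -scalerA -scalerBr.
  exact: subM.2.
- by apply: (uniq_coord v) => //; rewrite scale1r subrr; exact: subM.1.
- by move=> w /WM Mw; apply: (uniq_coord w) => //; rewrite scale0r subr0.
Qed.

Lemma dependent_or_dual (V : lmodType k) n (v : 'I_n.+1 -> V) i :
  (exists c : 'I_n -> k, v i = \sum_j c j *: v (lift i j)) \/
  (exists f : V -> k^o, [/\ linear f, f (v i) = 1 & forall j, f (v (lift i j)) = 0]).
Proof.
pose W x := exists c : 'I_n -> k, x = \sum_j c j *: v (lift i j).
have subW : subspace W.
  split=> [|a _ _ [c ->] [d ->]].
    by exists (fun=> 0); rewrite big1 // => j _; rewrite scale0r.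
  exists (fun j => a * c j + d j); rewrite scaler_sumr -big_split /=.
  by apply: eq_bigr => j _; rewrite scalerDl scalerA.
have [|nW] := pselect (W (v i)); first by left.
right; have [f [fL fv fW]] := separating_functional subW nW.
exists f; split=> // j; apply: fW; exists (fun l => (l == j)%:R).
rewrite (bigD1 j) //= eqxx scale1r big1 ?addr0 // => l /negPf ->.
by rewrite scale0r.
Qed.

Lemma tensor_sum (V W : lmodType k) (t : tensor V W) :
  exists n (v : 'I_n -> V) (w : 'I_n -> W), t = \sum_i v i ⊗ w i.
Proof.
have [s ->] : exists s : seq (V * W), t = \sum_(p <- s) p.1 ⊗ p.2.
  elim/tensor_ind: t => [v w||_ _ [s ->] [s' ->]|a _ [s ->]].
  - by exists [:: (v, w)]; rewrite big_seq1.
  - by exists [::]; rewrite big_nil.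
  - by exists (s ++ s'); rewrite big_cat.
  - exists [seq (a *: p.1, p.2) | p <- s]; rewrite big_map scaler_sumr.
    by apply: eq_bigr => p _; rewrite tensZl.
exists (size s), (fun i => (nth (0, 0) s i).1), (fun i => (nth (0, 0) s i).2).
by rewrite (big_nth (0, 0)) big_mkord.
Qed.

Lemma bil_scalel (V W : lmodType k) (f : V -> k^o) :
  linear f -> is_bilinear (fun v (w : W) => (f v : k) *: w).
Proof.
move=> fL; split=> [w a u v|u a v w] /=; first by rewrite fL scalerDl scalerA.
by rewrite scalerDr !scalerA mulrC.
Qed.

Lemma bil_scaler (V W : lmodType k) (f : V -> k^o) :
  linear f -> is_bilinear (fun (w : W) v => (f v : k) *: w).
Proof. by move=> /(bil_scalel W) [? ?]; split. Qed.

(** In an expression of [t] as a sum of the least possible number of pure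
    tensors, the left factors are linearly independent, and so are the right
    ones; functionals dual to one family then extract the other from [t]. *)
Lemma tensor_minimal_sum (V W : lmodType k) (t : tensor V W) :
  exists n (v : 'I_n -> V) (w : 'I_n -> W),
  [/\ t = \sum_i v i ⊗ w i,
      forall i, exists2 f : V -> k^o, linear f &
        w i = tens_lift (fun a b => (f a : k) *: b) t &
      forall i, exists2 g : W -> k^o, linear g &
        v i = tens_lift (fun a b => (g b : k) *: a) t].
Proof.
pose rep n := `[< exists (v : 'I_n -> V) (w : 'I_n -> W), t = \sum_i v i ⊗ w i >].
have ex : exists n, rep n.
  by have [n H] := tensor_sum t; exists n; apply/asboolP.
case: (ex_minnP ex) => -[|n] /asboolP[v [w tE]] min.
  by exists 0%N, v, w; split=> // -[].
exists n.+1, v, w; split=> // i.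
  have [[c vi]|[f [fL fi fj]]] := dependent_or_dual v i.
    suff /min : rep n by rewrite ltnn.
    apply/asboolP; exists (fun j => v (lift i j)), (fun j => w (lift i j) + c j *: w i).
    rewrite tE (bigD1_ord i) //= vi (lin_bigsum _ _ _ ((bil_tens _ _).1 _)) -big_split /=.
    by apply: eq_bigr => j _; rewrite tensDr tensZl tensZr addrC.
  exists f => //; have L := tens_lift_linear (bil_scalel W fL).
  rewrite tE (lin_bigsum _ _ _ L) (bigD1_ord i) //= big1 ?addr0.
    by rewrite tens_liftE ?fi ?scale1r //; apply: bil_scalel.
  by move=> j _; rewrite tens_liftE ?fj ?scale0r //; apply: bil_scalel.
have [[c wi]|[f [fL fi fj]]] := dependent_or_dual w i.
  suff /min : rep n by rewrite ltnn.
  apply/asboolP; exists (fun j => v (lift i j) + c j *: v i), (fun j => w (lift i j)).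
  rewrite tE (bigD1_ord i) //= wi (lin_bigsum _ _ _ ((bil_tens _ _).2 _)) -big_split /=.
  by apply: eq_bigr => j _; rewrite tensDl tensZl tensZr addrC.
exists f => //; have L := tens_lift_linear (bil_scaler V fL).
rewrite tE (lin_bigsum _ _ _ L) (bigD1_ord i) //= big1 ?addr0.
  by rewrite tens_liftE ?fi ?scale1r //; apply: bil_scaler.
by move=> j _; rewrite tens_liftE ?fj ?scale0r //; apply: bil_scaler.
Qed.

Lemma natf_inj : [pchar k] =i pred0 -> injective (fun n : nat => n%:R : k).
Proof.
move=> /pcharf0P nat0.
have le m n : (m <= n)%N -> m%:R = n%:R :> k -> m = n.
  move=> mn /eqP; rewrite eq_sym -subr_eq0 -natrB // nat0 subn_eq0 => nm.
  by apply/eqP; rewrite eqn_leq mn.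
move=> m n; case: (leqP m n) => [|/ltnW] mn e; first exact: le.
by apply/esym/le.
Qed.

(** Inverting a Vandermonde matrix on [0, 1, ..., M - 1] recovers the
    coefficients of a vector-valued polynomial from its values. *)
Lemma poly_coef_subspace (V : lmodType k) (S : set V) M (v : nat -> V) :
    [pchar k] =i pred0 -> subspace S ->
    (forall n : nat, S (\sum_(m < M) n%:R ^+ m *: v m)) ->
  forall m, (m < M)%N -> S (v m).
Proof.
move=> char0 subS Sv m mM.
pose A := Vandermonde M (\row_(n < M) (n%:R : k)).
have uA : A \in unitmx.
  rewrite unitmxE det_Vandermonde unitfE; apply/prodf_neq0 => i _.
  apply/prodf_neq0 => j ij; rewrite !mxE subr_eq0; apply/eqP => /(natf_inj char0) e.
  by rewrite e ltnn in ij.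
have -> : v m = \sum_(n < M) (invmx A) n (Ordinal mM) *:
    (\sum_(l < M) (n : nat)%:R ^+ l *: v l).
  transitivity (\sum_(l < M) ((A *m invmx A) l (Ordinal mM)) *: v l).
    rewrite mulmxV // (bigD1 (Ordinal mM)) //= mxE eqxx scale1r big1 ?addr0 //.
    by move=> l /negPf lm; rewrite mxE lm scale0r.
  under [RHS]eq_bigr => n _ do rewrite scaler_sumr.
  rewrite exchange_big; apply: eq_bigr => l _; rewrite mxE scaler_suml.
  by apply: eq_bigr => n _; rewrite scalerA !mxE mulrC.
by apply: subspace_sum => // n _; apply: subspaceZ.
Qed.

Lemma poly_coef_eq (V : lmodType k) M (v w : nat -> V) : [pchar k] =i pred0 ->
    (forall n : nat, \sum_(m < M) n%:R ^+ m *: v m = \sum_(m < M) n%:R ^+ m *: w m) ->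
  forall m, (m < M)%N -> v m = w m.
Proof.
move=> char0 vw m mM; apply/eqP; rewrite -subr_eq0; apply/eqP.
apply: (poly_coef_subspace (v := fun m => v m - w m) char0 (subspace0 V) _ mM) => n.
under eq_bigr => i _ do rewrite scalerBr.
by rewrite sumrB vw subrr.
Qed.

End LinearAlgebra.

(** * Irreducible cocommutative Hopf algebras are conilpotent *)

Section Sweedler.
Variables (k : fieldType) (C : coalgType k).

Lemma sw_linear (W : lmodType k) (F : C -> C -> W) : is_bilinear F ->
  linear (fun c => \sw_(a, b <- c) F a b).
Proof. by move=> FB; apply: lin_comp (tens_lift_linear FB) comul_linear. Qed.

Lemma sw_coassoc (W : lmodType k) (G : C -> C -> C -> W) c :
    (forall x, is_bilinear (G x)) -> (forall y z, linear (fun x => G x y z)) ->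
  \sw_(a, b <- c) \sw_(a1, a2 <- a) G a1 a2 b =
  \sw_(a, b <- c) \sw_(b1, b2 <- b) G a b1 b2.
Proof.
move=> GB GL.
have B : is_bilinear (fun x (t : tensor C C) => tens_lift (G x) t).
  exact: (bil_lift_r (F := G) (g := id)).
have L := tens_lift_linear B.
have := congr1 (tens_lift (fun x t => tens_lift (G x) t)) (comulA c).
rewrite !(linear_tens_lift _ _ L) => e.
transitivity (tens_lift (fun c1 c2 => tens_lift (fun x t => tens_lift (G x) t)
    (tens_lift (fun c11 c12 => c11 ⊗ (c12 ⊗ c2)) (comul c1))) (comul c)).
  apply: eq_tens_lift => a b; rewrite (linear_tens_lift _ _ L).
  by apply: eq_tens_lift => a1 a2; rewrite !tens_liftE.
by rewrite e; apply: eq_tens_lift => a b; rewrite tens_liftE.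
Qed.

Hypothesis cocomm : cocommutative_coalg C.

Lemma sw_swap (W : lmodType k) (F : C -> C -> W) c : is_bilinear F ->
  \sw_(a, b <- c) F a b = \sw_(a, b <- c) F b a.
Proof.
move=> FB; rewrite -{1}(cocomm c) (linear_tens_lift _ _ (tens_lift_linear FB)).
by apply: eq_tens_lift => a b; rewrite tens_liftE.
Qed.

(** Coassociativity brings the second and third of four Sweedler factors into a
    single coproduct, where cocommutativity exchanges them. *)
Lemma sw_middle_swap (W : lmodType k) (G : C -> C -> C -> C -> W) c :
    (forall y z t, linear (fun x => G x y z t)) ->
    (forall x z t, linear (fun y => G x y z t)) ->
    (forall x y t, linear (fun z => G x y z t)) ->
    (forall x y z, linear (fun t => G x y z t)) ->
  \sw_(a, b <- c) \sw_(a1, a2 <- a) \sw_(b1, b2 <- b) G a1 a2 b1 b2 =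
  \sw_(a, b <- c) \sw_(a1, a2 <- a) \sw_(b1, b2 <- b) G a1 b1 a2 b2.
Proof.
move=> L1 L2 L3 L4.
have swL (U : lmodType k) (F : U -> C -> C -> W) t :
    (forall y z, linear (fun x => F x y z)) -> linear (fun x => tens_lift (F x) t).
  move=> FL a u v; rewrite -tens_lift_scale -tens_lift_add.
  by apply: eq_tens_lift => x y; apply: FL.
have reassoc (K : C -> C -> C -> C -> W) :
    (forall y z t, linear (fun x => K x y z t)) ->
    (forall x z t, linear (fun y => K x y z t)) ->
    (forall x y t, linear (fun z => K x y z t)) ->
    (forall x y z, linear (fun t => K x y z t)) ->
  \sw_(a, b <- c) \sw_(a1, a2 <- a) \sw_(b1, b2 <- b) K a1 a2 b1 b2 =
  \sw_(a, b <- c) \sw_(d, b2 <- b) \sw_(b1, b3 <- d) K a b1 b3 b2.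
  move=> K1 K2 K3 K4.
  rewrite (sw_coassoc (G := fun a1 a2 b => \sw_(b1, b2 <- b) K a1 a2 b1 b2)).
  - apply: eq_tens_lift => a b; rewrite -(sw_coassoc (G := K a)) //.
  - move=> x; split=> [y|y]; first exact: swL.
    by apply: sw_linear; split.
  - by move=> y z; apply: swL.
rewrite !reassoc //; apply: eq_tens_lift => a b; apply: eq_tens_lift => d b2.
by apply: sw_swap; split.
Qed.

End Sweedler.

Section Functionals.
Variables (k : fieldType) (C : coalgType k).

(** The coadjoint action of the dual algebra: [f ⇀ c = ∑ f(c₂) c₁]. *)
Definition hit (f : C -> k^o) (c : C) : C :=
  tens_lift (fun a b : C => (f b : k) *: a) (comul c).

Lemma hit_linear f : linear f -> linear (hit f).
Proof. by move=> fL; apply: sw_linear; apply: bil_scaler. Qed.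

Lemma hit_counit c : hit counit c = c.
Proof. exact: counitr. Qed.

Lemma hit_hit f g c : linear f -> linear g ->
  hit f (hit g c) =
  tens_lift (fun a b : C => \sw_(b1, b2 <- b) (g b2 : k) *: ((f b1 : k) *: a)) (comul c).
Proof.
move=> fL gL; rewrite {2}/hit (linear_tens_lift _ _ (hit_linear fL)).
rewrite -(sw_coassoc (G := fun a1 a2 b => (g b : k) *: ((f a2 : k) *: a1))).
- apply: eq_tens_lift => a b; rewrite (linZ (hit_linear fL)).
  by rewrite /hit -tens_lift_scale.
- move=> x; split=> [z|y] a u v /=.
    by rewrite fL scalerDl !scalerDr !scalerA mulrCA mulrA.
  by rewrite gL scalerDl !scalerA mulrA.
- move=> y z a u v.
  by rewrite !scalerDr !scalerA mulrC (mulrC _ (f y)) !mulrA mulrC mulrA.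
Qed.

(** The witness is the convolution product of the two functionals. *)
Lemma hit_hit_ex f g : linear f -> linear g ->
  exists2 e : C -> k^o, linear e & forall c, hit f (hit g c) = hit e c.
Proof.
move=> fL gL; exists (fun c => \sw_(b1, b2 <- c) (g b2 * f b1 : k^o)).
  apply: sw_linear; split=> [z|y] a u v /=.
    by rewrite fL mulrDr -scalerAr.
  by rewrite gL mulrDl -scalerAl.
move=> c; rewrite hit_hit //; apply: eq_tens_lift => a b.
have L : linear (fun x : k^o => x *: a) by move=> x u v; rewrite scalerDl scalerA.
by rewrite (linear_tens_lift _ _ L); apply: eq_tens_lift => b1 b2; rewrite scalerA.
Qed.

Hypothesis cocomm : cocommutative_coalg C.

Lemma hit_comm f g c : linear f -> linear g -> hit f (hit g c) = hit g (hit f c).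
Proof.
move=> fL gL; rewrite !hit_hit //; apply: eq_tens_lift => a b.
rewrite sw_swap //; last first.
  split=> [z|y] x u v /=.
    by rewrite fL scalerDl !scalerDr !scalerA mulrCA mulrA.
  by rewrite gL scalerDl !scalerA mulrA.
by apply: eq_tens_lift => b1 b2; rewrite !scalerA mulrC.
Qed.

(** Both families of factors of a minimal expression of [comul c] are
    contractions of [c], by functionals in the right factor and, after swapping,
    in the left one. *)
Lemma hit_stable_subcoalgebra (D : set C) : subspace D ->
    (forall f c, linear f -> D c -> D (hit f c)) -> is_subcoalgebra D.
Proof.
move=> subD Dhit; split=> // c Dc.
have [n [v [w [cE wE vE]]]] := tensor_minimal_sum (comul c).
exists [seq (v i, w i) | i <- enum 'I_n]; split; last by rewrite big_map big_enum.
move=> _ /mapP[i _ ->] /=; split.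
  by have [g gL ->] := vE i; apply: Dhit.
have [f fL ->] := wE i; rewrite sw_swap //; last exact: bil_scalel.
exact: Dhit.
Qed.

End Functionals.

Section Conilpotent.
Variables (k : fieldType) (H : hopfAlgType k).

(** The wedge powers of the line [k 1]; in a connected coalgebra this is the
    coradical filtration, with index shifted by one. *)
Fixpoint fil (n : nat) (h : H) : Prop :=
  match n with
  | 0 => h = 0
  | n.+1 => forall f : H -> k^o, linear f -> f 1 = 0 -> fil n (hit f h)
  end.

Lemma fil0 n : fil n 0.
Proof. by elim: n => //= n IH f fL _; rewrite (lin0 (hit_linear fL)). Qed.

Lemma filS n h : fil n h -> fil n.+1 h.
Proof.
elim: n h => [h -> f fL _|n IH h Fh f fL f1].
  by rewrite (lin0 (hit_linear fL)).
exact/IH/Fh.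
Qed.

Lemma fil_leq m n h : (m <= n)%N -> fil m h -> fil n h.
Proof.
move=> /subnKC <- Fh.
by elim: (n - m)%N => [|j IH]; rewrite ?addn0 // addnS; apply: filS.
Qed.

Lemma hit1 (f : H -> k^o) : linear f -> hit f 1 = (f 1 : k) *: 1.
Proof. by move=> fL; rewrite /hit comul1 tens_liftE //; apply: bil_scaler. Qed.

Lemma fil_comul n h : fil n.+1 h -> exists m (a b : 'I_m -> H),
  comul h = h ⊗ 1 + \sum_i a i ⊗ b i /\ forall i, fil n (a i).
Proof.
move=> Fh.
(* Since the right factors of [comul h - h ⊗ 1] lie in the kernel of the counit,
   replacing [g] by [g - g(1) counit] does not change the left factors. *)
have [m [a [b [tE _ aE]]]] := tensor_minimal_sum (comul h - h ⊗ 1).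
exists m, a, b; rewrite -tE addrC subrK; split=> // i.
have [g gL ->] := aE i.
have L := tens_lift_linear (bil_scaler H gL).
rewrite (linD L) (linN L) tens_liftE; last exact: bil_scaler.
pose g' c : k^o := g c + - g 1 *: (counit c : k^o).
have g'L : linear g'.
  move=> x u v; rewrite /g' gL counit_linear !scalerDr addrACA; congr (_ + (_ + _)).
  by rewrite !scalerA mulrC -scalerA.
have -> : tens_lift (fun x y => (g y : k) *: x) (comul h) - (g 1 : k) *: h = hit g' h.
  rewrite /hit -[in X in _ - X](hit_counit h) -scaleNr -tens_lift_scale -tens_lift_add.
  by apply: eq_tens_lift => x y; rewrite scalerDl !scalerA.
apply: Fh => //.
by rewrite /g' counit1 -[_ *: _]/(- g 1 * 1) mulr1 subrr.
Qed.

Hypothesis irr : irreducible_coalg H.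
Hypothesis cocomm : cocommutative_coalg H.

(** A nonzero subcoalgebra meets the subcoalgebra [k 1]. *)
Lemma irreducible_contains1 (D : set H) :
  is_subcoalgebra D -> nonzero_subset D -> D 1.
Proof.
move=> subD D0; pose K (x : H) := exists c : k, x = c *: 1.
have subK : is_subcoalgebra K.
  split=> [|_ [c ->]].
    split=> [|a _ _ [c ->] [d ->]]; first by exists 0; rewrite scale0r.
    by exists (a * c + d); rewrite scalerDl scalerA.
  exists [:: (c *: 1, 1)]; split.
    move=> p; rewrite inE => /eqP -> /=; split; first by exists c.
    by exists 1; rewrite scale1r.
  by rewrite big_seq1 /= (linZ comul_linear) comul1 tensZl.
have K0 : nonzero_subset K.
  by exists 1; [exists 1; rewrite scale1r | exact: oner_neq0].
have [x [Dx [c xE]] x0] := irr subD subK D0 K0.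
move: Dx x0; rewrite xE => Dc c0.
apply: (subspace_scaleI subD.1 (a := c)) Dc.
by apply: contraNneq c0 => ->; rewrite scale0r.
Qed.

Definition spanned n (v : 'I_n -> H) : set H :=
  fun x => exists c : 'I_n -> k, x = \sum_i c i *: v i.

Lemma spanned_subspace n (v : 'I_n -> H) : subspace (spanned v).
Proof.
split=> [|a _ _ [c ->] [d ->]].
  by exists (fun=> 0); rewrite big1 // => j _; rewrite scale0r.
exists (fun j => a * c j + d j); rewrite scaler_sumr -big_split /=.
by apply: eq_bigr => j _; rewrite scalerDl scalerA.
Qed.

Lemma spanned_gen n (v : 'I_n -> H) i : spanned v (v i).
Proof.
exists (fun j => (j == i)%:R); rewrite (bigD1 i) //= eqxx scale1r big1 ?addr0 //.
by move=> l /negPf ->; rewrite scale0r.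
Qed.

(** A nonzero stable subspace is a subcoalgebra, so it contains [1]; contraction
    with a functional vanishing at [1] kills [1], and hence maps it onto a stable
    subspace with one generator less. *)
Lemma fil_spanned n (v : 'I_n -> H) :
    (forall f h, linear f -> spanned v h -> spanned v (hit f h)) ->
  forall h, spanned v h -> fil n h.
Proof.
elim: n v => [|n IH] v vS h vh.
  by case: vh => c ->; rewrite big_ord0.
move=> f fL f1; have subv := spanned_subspace v.
have [[x vx x0]|v0] := pselect (nonzero_subset (spanned v)); last first.
  suff -> : hit f h = 0 by apply: fil0.
  have [//|/eqP h0] := pselect (hit f h = 0).
  by case: v0; exists (hit f h); first exact: vS.
have [c cE] : spanned v 1.
  by apply: irreducible_contains1; [exact: hit_stable_subcoalgebra | exists x].
have [i ci] : exists i, c i != 0.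
  apply: contrapT => nc; move/eqP: (cE); rewrite big1 ?oner_eq0 // => i _.
  by have [->|/eqP ci] := pselect (c i = 0); [rewrite scale0r | case: nc; exists i].
pose v' j := hit f (v (lift i j)); have fL' := hit_linear fL.
have vi : spanned v' (hit f (v i)).
  apply: (subspace_scaleI (spanned_subspace v') ci).
  have : hit f (\sum_i0 c i0 *: v i0) = 0 by rewrite -cE hit1 // f1 scale0r.
  rewrite (lin_bigsum _ _ _ fL') (bigD1_ord i) //= (linZ fL') => /eqP.
  rewrite addr_eq0 => /eqP ->; apply: (subspaceN (spanned_subspace v')).
  by exists (fun j => c (lift i j)); apply: eq_bigr => j _; rewrite (linZ fL').
have hitv y : spanned v y -> spanned v' (hit f y).
  case=> d ->; rewrite (lin_bigsum _ _ _ fL'); have sub' := spanned_subspace v'.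
  apply: (subspace_sum sub') => j _; rewrite (linZ fL'); apply: (subspaceZ sub').
  have [->//|] := eqVneq j i; rewrite eq_sym => /unlift_some[l -> _].
  exact: (spanned_gen v').
apply: (IH v'); last exact: hitv.
move=> g _ gL [d ->].
rewrite (lin_bigsum _ _ _ (hit_linear gL)).
apply: (subspace_sum (spanned_subspace v')) => j _.
rewrite (linZ (hit_linear gL)); apply: (subspaceZ (spanned_subspace v')).
by rewrite /v' hit_comm //; apply/hitv/vS => //; exact: spanned_gen.
Qed.

(** The left factors of a minimal expression of [comul h] are contractions of
    [h] and span all of them, so they span a stable subspace containing [h]. *)
Lemma fil_exhaustive h : exists n, fil n h.
Proof.
have [n [a [b [hE _ aE]]]] := tensor_minimal_sum (comul h).
have hitE f : linear f -> spanned a (hit f h).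
  move=> fL; rewrite /hit hE; have FB := bil_scaler H fL.
  rewrite (lin_bigsum _ _ _ (tens_lift_linear FB)); exists (fun i => f (b i)).
  by apply: eq_bigr => i _; rewrite tens_liftE.
exists n; apply: (fil_spanned (v := a)); last first.
  by rewrite -[h]hit_counit; apply: hitE; exact: counit_linear.
move=> f _ fL [c ->]; have suba := spanned_subspace a.
rewrite (lin_bigsum _ _ _ (hit_linear fL)); apply: (subspace_sum suba) => i _.
rewrite (linZ (hit_linear fL)); apply: (subspaceZ suba).
have [g gL aiE] := aE i; rewrite [a i]aiE -/(hit g h).
by have [e eL ->] := hit_hit_ex fL gL; apply: hitE.
Qed.

End Conilpotent.

(** * Convolution powers *)

Section Sums.

Lemma big_ord_zero_tail (V : nmodType) (F : nat -> V) M N : (M <= N)%N ->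
  (forall m, (M <= m)%N -> F m = 0) -> \sum_(m < N) F m = \sum_(m < M) F m.
Proof.
move=> MN F0; rewrite (big_ord_widen N F MN) [RHS]big_mkcond /=.
by apply: eq_bigr => i _; case: ltnP => // /F0.
Qed.

Lemma cauchy_product (V : nmodType) (g : nat -> nat -> V) K :
    (forall i j, (K <= i)%N -> g i j = 0) -> (forall i j, (K <= j)%N -> g i j = 0) ->
  \sum_(i < K) \sum_(j < K) g i j = \sum_(m < K + K) \sum_(i < m.+1) g i (m - i)%N.
Proof.
move=> gl gr.
transitivity (\sum_(m < K + K) \sum_(i < K + K | (i <= m)%N) g i (m - i)%N); last first.
  apply: eq_bigr => m _.
  by rewrite (big_ord_widen (K + K) (fun i => g i (m - i)%N) (ltn_ord m)).
rewrite [RHS](exchange_big_dep predT) //=.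
transitivity (\sum_(i < K) \sum_(m < K + K | (i <= m)%N) g i (m - i)%N); last first.
  symmetry; apply: (big_ord_zero_tail
    (F := fun i => \sum_(m < K + K | (i <= m)%N) g i (m - i)%N) (leq_addr K K)).
  by move=> i Ki; rewrite big1 // => m _; apply: gl.
apply: eq_bigr => i _.
rewrite -(big_geq_mkord _ _ predT (fun m => g i (m - i)%N)).
rewrite -[X in bigop.body _ (index_iota X _)]add0n big_addn big_mkord.
under [RHS]eq_bigr => j _ do rewrite addnK.
symmetry; apply: (big_ord_zero_tail (F := g i) _ (gr i)).
by rewrite -addnBA ?leq_addr // ltnW.
Qed.

Lemma tens_lift_sum (k : fieldType) (U V W : lmodType k) (I : Type) (r : seq I)
    (c : I -> k) (F : I -> U -> V -> W) t :
  tens_lift (fun u v => \sum_(i <- r) c i *: F i u v) t =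
  \sum_(i <- r) c i *: tens_lift (F i) t.
Proof.
elim: r => [|i r IH].
  rewrite big_nil -[RHS](scale0r (tens_lift (fun _ _ => 0) t)) -tens_lift_scale.
  by apply: eq_tens_lift => u v; rewrite big_nil scale0r.
rewrite big_cons -IH -tens_lift_scale -tens_lift_add.
by apply: eq_tens_lift => u v; rewrite big_cons.
Qed.

Lemma tens_lift_id (k : fieldType) (U V : lmodType k) (t : tensor U V) :
  tens_lift (fun u v => u ⊗ v) t = t.
Proof.
apply: (tens_ext (tens_lift_linear (bil_tens U V)) (@lin_id _ _)) => u v.
by rewrite tens_liftE //; apply: bil_tens.
Qed.

End Sums.

Section Convolution.
Variables (k : fieldType) (C : coalgType k) (A : algType k).

Definition conv (f g : C -> A) (c : C) : A := \sw_(a, b <- c) f a * g b.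

Fixpoint cpow (f : C -> A) (n : nat) : C -> A :=
  match n with
  | 0 => fun c => (counit c)%:A
  | n.+1 => conv (cpow f n) f
  end.

Lemma cpowS f n c : cpow f n.+1 c = conv (cpow f n) f c.
Proof. by []. Qed.

Lemma conv_linear f g : linear f -> linear g -> linear (conv f g).
Proof. by move=> fL gL; apply: sw_linear; exact: bil_comp (bil_mul A) fL gL. Qed.

Lemma counit_scalel (W : lmodType k) (f : C -> W) c : linear f ->
  \sw_(a, b <- c) counit a *: f b = f c.
Proof.
move=> fL; rewrite -[in RHS](counitl c) (linear_tens_lift _ _ fL).
by apply: eq_tens_lift => a b; rewrite (linZ fL).
Qed.

Lemma counit_scaler (W : lmodType k) (f : C -> W) c : linear f ->
  \sw_(a, b <- c) counit b *: f a = f c.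
Proof.
move=> fL; rewrite -[in RHS](counitr c) (linear_tens_lift _ _ fL).
by apply: eq_tens_lift => a b; rewrite (linZ fL).
Qed.

Lemma convA f g e c : linear f -> linear g -> linear e ->
  conv (conv f g) e c = conv f (conv g e) c.
Proof.
move=> fL gL eL.
transitivity (\sw_(a, b <- c) \sw_(a1, a2 <- a) f a1 * (g a2 * e b)).
  apply: eq_tens_lift => a b; rewrite (linear_tens_lift _ _ (lin_mulr (e b))).
  by apply: eq_tens_lift => a1 a2; rewrite mulrA.
rewrite (sw_coassoc (G := fun x y z => f x * (g y * e z))).
- by apply: eq_tens_lift => a b; rewrite (linear_tens_lift _ _ (lin_mull (f a))).
- move=> x; apply: bil_post (lin_mull (f x)) _.
  exact: bil_comp (bil_mul A) gL eL.
- by move=> y z; apply: lin_comp (lin_mulr _) fL.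
Qed.

Lemma conv_unitr f c : linear f -> conv f (fun b => (counit b)%:A) c = f c.
Proof.
move=> fL; rewrite -[RHS]counit_scaler //.
by apply: eq_tens_lift => a b; rewrite -scalerAr mulr1.
Qed.

Variable f : C -> A.
Hypothesis fL : linear f.

Lemma cpow_linear n : linear (cpow f n).
Proof.
elim: n => [|n IH] /=; last exact: conv_linear.
by move=> a u v; rewrite counit_linear scalerDl scalerA.
Qed.

Lemma cpow_add m n c : cpow f (m + n) c = conv (cpow f m) (cpow f n) c.
Proof.
elim: n c => [|n IH] c.
  by rewrite addn0 conv_unitr //; apply: cpow_linear.
rewrite addnS /= -convA //; try exact: cpow_linear.
by apply: eq_tens_lift => a b; rewrite IH.
Qed.

Lemma cpow1 c : cpow f 1 c = f c.
Proof.
rewrite -[RHS]counit_scalel //.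
by apply: eq_tens_lift => a b; rewrite -scalerAl mul1r.
Qed.

End Convolution.

Lemma cpow_fil (k : fieldType) (H : hopfAlgType k) (A : algType k) (f : H -> A) n h :
  linear f -> f 1 = 0 -> fil n h -> cpow f n h = 0.
Proof.
move=> fL f1; elim: n h => [|n IH] h.
  by move=> /= ->; rewrite (lin0 (V := k^o) (@counit_linear _ _)) scale0r.
move=> /fil_comul[m [a [b [hE aF]]]]; rewrite /= /conv hE.
have B := bil_comp (bil_mul A) (cpow_linear fL n) fL.
have L := tens_lift_linear B.
rewrite (linD L) (lin_bigsum _ _ _ L) tens_liftE // f1 mulr0 add0r big1 // => i _.
by rewrite tens_liftE // IH // mul0r.
Qed.

Section BinomialPolynomial.
Variable k : fieldType.
Hypothesis char0 : [pchar k] =i pred0.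

Definition binpoly (j : nat) : {poly k} :=
  (j`!%:R)^-1 *: \prod_(i < j) ('X - (i%:R)%:P).

Lemma natk_neq0 n : (n%:R == 0 :> k) = (n == 0%N).
Proof. by move/pcharf0P: char0. Qed.

Lemma factk_neq0 n : n`!%:R != 0 :> k.
Proof. by rewrite natk_neq0 -lt0n fact_gt0. Qed.

Lemma size_binpoly j : (size (binpoly j) <= j.+1)%N.
Proof.
apply: leq_trans (size_scale_leq _ _) _.
by rewrite size_prod_XsubC /index_enum -enumT size_enum_ord.
Qed.

Lemma binpolyE j n : (binpoly j).[n%:R] = 'C(n, j)%:R.
Proof.
rewrite hornerZ horner_prod.
apply: (mulfI (factk_neq0 j)); rewrite mulrA divff ?factk_neq0 // mul1r.
rewrite -natrM mulnC bin_ffact ffact_prod natr_prod.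
have [nj|jn] := ltnP n j.
  rewrite (bigD1 (Ordinal nj)) //= [RHS](bigD1 (Ordinal nj)) //=.
  by rewrite !hornerE subrr subnn !mul0r.
apply: eq_bigr => i _; rewrite !hornerE natrB //.
by rewrite (leq_trans _ jn) // ltnW.
Qed.

End BinomialPolynomial.

Definition primitive_elt (k : fieldType) (H : hopfAlgType k) (x : H) : Prop :=
  comul x = x ⊗ 1 + 1 ⊗ x.

Lemma hopf_antipode1 (k : fieldType) (H : hopfAlgType k) : antipode (1 : H) = 1.
Proof.
have B : is_bilinear (fun a b : H => a * antipode b).
  exact: bil_comp (bil_mul H) (@lin_id _ _) antipode_linear.
by have := antipoder (1 : H); rewrite comul1 tens_liftE // mul1r counit1 scale1r.
Qed.

Section PrimitivePowers.
Variables (k : fieldType) (H : hopfAlgType k) (x : H).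
Hypothesis px : primitive_elt x.

Lemma primitive_counit : counit x = 0.
Proof.
have := counitl x; rewrite px.
rewrite (linD (tens_lift_linear (bil_scalel H (@counit_linear k H)))).
rewrite !tens_liftE; try exact: bil_scalel (@counit_linear k H).
rewrite counit1 scale1r => /eqP; rewrite -subr_eq0 addrK scaler_eq0 oner_eq0 orbF.
by move/eqP.
Qed.

Lemma comul_primitive_exp j :
  comul (x ^+ j) = \sum_(i < j.+1) (x ^+ (j - i) ⊗ x ^+ i) *+ 'C(j, i).
Proof.
have cX : comul (x ^+ j) = comul x ^+ j.
  by elim: j => [|j IH]; rewrite ?expr0 ?comul1 // !exprS comulM IH.
have xl i : (x ⊗ (1 : H)) ^+ i = x ^+ i ⊗ 1.
  by elim: i => [|i IH]; rewrite ?expr0 // !exprS IH tensor_mulE mulr1.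
have xr i : ((1 : H) ⊗ x) ^+ i = 1 ⊗ x ^+ i.
  by elim: i => [|i IH]; rewrite ?expr0 // !exprS IH tensor_mulE mulr1.
rewrite cX px exprDn_comm; last by rewrite /GRing.comm !tensor_mulE !mulr1 !mul1r.
by apply: eq_bigr => i _; rewrite xl xr tensor_mulE mulr1 mul1r.
Qed.

Lemma conv_primitive_exp (A : algType k) (f g : H -> A) j : linear f -> linear g ->
  conv f g (x ^+ j) = \sum_(i < j.+1) (f (x ^+ (j - i)) * g (x ^+ i)) *+ 'C(j, i).
Proof.
move=> fL gL; have B := bil_comp (bil_mul A) fL gL.
rewrite /conv comul_primitive_exp (lin_bigsum _ _ _ (tens_lift_linear B)).
apply: eq_bigr => i _; rewrite -scaler_nat (linZ (tens_lift_linear B)) scaler_nat.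
by rewrite tens_liftE.
Qed.

Lemma counit_primitive_exp j : counit (x ^+ j) = (j == 0%N)%:R.
Proof.
case: j => [|j]; first by rewrite expr0 counit1.
by rewrite exprS counitM primitive_counit mul0r.
Qed.

(** The powers of [x] have the binomial coproduct of the monomials in one
    variable, whose convolution algebra of functionals is that of power series in
    a dual variable [t], with [t^m] taking the value [m!] on [x^m] and [0] on the
    other powers. Here [f] is the series [y t]. *)
Lemma cpow_primitive_exp (A : algType k) (f : H -> A) (y : A) m j : linear f ->
    (forall i, f (x ^+ i) = (i == 1%N)%:R *: y) ->
  cpow f m (x ^+ j) = ((m == j)%:R * m`!%:R) *: y ^+ m.
Proof.
move=> fL fx; elim: m j => [|m IH] j.
  by rewrite /= counit_primitive_exp eq_sym fact0 mulr1 expr0.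
rewrite cpowS conv_primitive_exp //; last exact: cpow_linear.
case: j => [|j].
  by rewrite big_ord1 fx scale0r mulr0 mul0rn mul0r scale0r.
rewrite (bigD1 (Ordinal (isT : 1 < j.+2)%N)) //= big1 ?addr0 => [|i]; last first.
  rewrite -val_eqE /= => /negPf i1.
  by rewrite fx i1 scale0r mulr0 mul0rn.
rewrite fx scale1r IH subn1 /= bin1 eqSS.
have [->|_] := eqVneq m j; last by rewrite !mul0r !scale0r mul0r mul0rn.
rewrite !mul1r -scalerAl -exprSr -scaler_nat scalerA factS natrM //.
Qed.

Lemma cpow_id_primitive_exp n j :
  cpow id n (x ^+ j) = (n%:R ^+ j : k) *: x ^+ j.
Proof.
elim: n j => [|n IH] j.
  rewrite /= counit_primitive_exp expr0n.
  by have [->|_] := eqVneq j 0%N; rewrite ?expr0 // !scale0r.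
rewrite cpowS conv_primitive_exp //; last exact: cpow_linear.
rewrite -natr1 exprDn scaler_suml; apply: eq_bigr => i _.
have ij : (i <= j)%N by rewrite -ltnS.
rewrite IH -scalerAl -exprD subnK // expr1n mulr1.
by rewrite -!scaler_nat scalerA mulr_natl.
Qed.

Lemma primitive_antipode : antipode x = - x.
Proof.
have B : is_bilinear (fun a b : H => a * antipode b).
  exact: bil_comp (bil_mul H) (@lin_id _ _) antipode_linear.
have L := tens_lift_linear B.
have := antipoder x; rewrite px (linD L) !tens_liftE // primitive_counit scale0r.
by rewrite hopf_antipode1 mulr1 mul1r => /eqP; rewrite addrC addr_eq0 => /eqP.
Qed.

End PrimitivePowers.

(** On a cocommutative coalgebra the convolution product of two coalgebra maps
    into a bialgebra is again a coalgebra map. *)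
Lemma comul_cpow_id (k : fieldType) (H : hopfAlgType k) n (h : H) :
  cocommutative_coalg H ->
  comul (cpow id n h) = \sw_(a, b <- h) cpow id n a ⊗ cpow id n b.
Proof.
move=> cocomm; set P := cpow id; have PL m : linear (P m) by exact: cpow_linear.
elim: n h => [|n IH] h.
  transitivity (counit h *: (1 : H) ⊗ (1 : H)).
    by rewrite /P /= (linZ comul_linear) comul1 tensZl.
  rewrite -{1}(counitl h).
  rewrite (linear_tens_lift (g := fun c => counit c *: (1 : H) ⊗ (1 : H))).
    apply: eq_tens_lift => a b; rewrite (linZ (V := k^o) (@counit_linear _ _)).
    by rewrite tensZr !tensZl scalerA mulrC.
  by move=> a u v; rewrite counit_linear scalerDl tensDl -scalerA [(a *: _) ⊗ _]tensZl.
rewrite [comul _](linear_tens_lift _ _ comul_linear).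
transitivity (\sw_(a, b <- h) \sw_(a1, a2 <- a) \sw_(b1, b2 <- b)
    (P n a1 * b1) ⊗ (P n a2 * b2)).
  apply: eq_tens_lift => a b; rewrite comulM IH.
  rewrite (linear_tens_lift _ _ ((@tensor_mul_bilinear _ _ _).1 _)).
  apply: eq_tens_lift => a1 a2; rewrite -[comul b in LHS]tens_lift_id.
  rewrite (linear_tens_lift _ _ ((@tensor_mul_bilinear _ _ _).2 _)).
  by apply: eq_tens_lift => b1 b2; rewrite tensor_mulE.
rewrite (sw_middle_swap cocomm (G := fun a1 a2 b1 b2 => (P n a1 * b1) ⊗ (P n a2 * b2))).
- apply: eq_tens_lift => a b.
  rewrite (linear_tens_lift _ _ ((bil_tens H H).1 _)).
  apply: eq_tens_lift => a1 a2.
  by rewrite (linear_tens_lift _ _ ((bil_tens H H).2 _)).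
- move=> y z t; apply: lin_comp ((bil_tens H H).1 _) _.
  exact: lin_comp (lin_mulr _) (PL n).
- move=> x z t; apply: lin_comp ((bil_tens H H).2 _) _.
  exact: lin_comp (lin_mulr _) (PL n).
- by move=> x y t; apply: lin_comp ((bil_tens H H).1 _) (lin_mull _).
- by move=> x y z; apply: lin_comp ((bil_tens H H).2 _) (lin_mull _).
Qed.

(** * Eulerian components *)

Section Eulerian.
Variables (k : fieldType) (H : hopfAlgType k).
Hypothesis char0 : [pchar k] =i pred0.
Hypothesis conilpotent : forall h : H, exists n, fil n h.

Definition aug (h : H) : H := h - (counit h)%:A.

Lemma aug_linear : linear aug.
Proof.
move=> a u v; rewrite /aug counit_linear scalerDl scalerBr opprD addrACA.
by rewrite scalerA.
Qed.

Lemma aug1 : aug 1 = 0.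
Proof. by rewrite /aug counit1 scale1r subrr. Qed.

(** The binomial formula in the convolution algebra, where [id] is the unit
    plus [aug]. *)
Lemma cpow_id_binomial M n h : (n < M)%N ->
  cpow id n h = \sum_(j < M) 'C(n, j)%:R *: cpow aug j h.
Proof.
case: M => // M; elim: n h => [|n IH] h nM.
  rewrite big_ord_recl bin0 scale1r big1 ?addr0 // => j _.
  by rewrite bin0n scale0r.
have nM' : (n < M.+1)%N by apply: ltnW.
transitivity (conv (cpow id n) aug h + cpow id n h).
  rewrite cpowS -[cpow id n h in RHS]conv_unitr; last exact: cpow_linear.
  rewrite /conv -tens_lift_add; apply: eq_tens_lift => a b.
  by rewrite -mulrDr subrK.
have -> : conv (cpow id n) aug h = \sum_(j < M.+1) 'C(n, j)%:R *: cpow aug j.+1 h.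
  rewrite -tens_lift_sum; apply: eq_tens_lift => a b.
  rewrite IH // mulr_suml; apply: eq_bigr => j _.
  by rewrite scalerAl.
rewrite IH // big_ord_recr /= bin_small // scale0r addr0.
rewrite big_ord_recl [RHS]big_ord_recl !bin0 addrCA -big_split; congr (_ + _).
by apply: eq_bigr => j _ /=; rewrite /bump leq0n !add1n -scalerDl -natrD addnC -binS.
Qed.

Definition level (h : H) : nat := projT1 (cid (conilpotent h)).

Lemma levelP h : fil (level h) h.
Proof. exact: projT2 (cid (conilpotent h)). Qed.

Lemma cpow_aug_level j h : (level h <= j)%N -> cpow aug j h = 0.
Proof.
by move=> hj; apply: (cpow_fil aug_linear aug1); apply: fil_leq (levelP h).
Qed.

(** The convolution power [id^{*n}] applied to [h] is polynomial in [n], and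
    [euler m h] is the coefficient of [n ^ m]. *)
Definition euler (m : nat) (h : H) : H :=
  \sum_(j < level h) (binpoly k j)`_m *: cpow aug j h.

Lemma euler_bound M m h : (level h <= M)%N ->
  euler m h = \sum_(j < M) (binpoly k j)`_m *: cpow aug j h.
Proof.
move=> hM; symmetry.
apply: (big_ord_zero_tail (F := fun j => (binpoly k j)`_m *: cpow aug j h)) => // j hj.
by rewrite cpow_aug_level // scaler0.
Qed.

Lemma euler_linear m : linear (euler m).
Proof.
move=> a u v; pose M := maxn (maxn (level u) (level v)) (level (a *: u + v)).
rewrite !(@euler_bound M) ?leq_max ?leqnn ?orbT // scaler_sumr -big_split /=.
apply: eq_bigr => j _; rewrite (cpow_linear aug_linear) scalerDr !scalerA.
by rewrite mulrC.
Qed.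

Lemma euler_level m h : (level h <= m)%N -> euler m h = 0.
Proof.
move=> hm; rewrite /euler big1 // => j _; rewrite nth_default ?scale0r //.
apply: leq_trans (size_binpoly k j) _.
exact: leq_trans (ltn_ord j) hm.
Qed.

Lemma cpow_id_euler M n h : (level h <= M)%N ->
  cpow id n h = \sum_(m < M) n%:R ^+ m *: euler m h.
Proof.
move=> hM; rewrite (@cpow_id_binomial (M + n.+1)) ?addnS ?ltnS ?leq_addl //.
rewrite (big_ord_zero_tail (F := fun j => 'C(n, j)%:R *: cpow aug j h) (M := M)).
- under [RHS]eq_bigr => m _ do rewrite (euler_bound _ hM) scaler_sumr.
  rewrite exchange_big; apply: eq_bigr => j _.
  rewrite -(binpolyE char0) (horner_coef_wide _ (n := M)); last first.
    by apply: leq_trans (size_binpoly k j) _.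
  rewrite scaler_suml; apply: eq_bigr => m _.
  by rewrite scalerA mulrC.
- exact: leqW (leq_addr _ _).
- by move=> m Mm; rewrite cpow_aug_level ?scaler0 // (leq_trans hM).
Qed.

Lemma euler0 h : euler 0 h = (counit h)%:A.
Proof.
have := @cpow_id_euler (level h).+1 0 h (leqnSn _).
rewrite big_ord_recl expr0 scale1r big1 ?addr0 // => j _.
by rewrite expr0n scale0r.
Qed.

Lemma euler_sum h : h = \sum_(m < level h) euler m h.
Proof.
rewrite -[LHS](cpow1 (f := id)) // (cpow_id_euler _ (leqnn _)).
by apply: eq_bigr => m _; rewrite expr1n scale1r.
Qed.

(** A family [w] whose generating polynomial in [n] is a bilinear expression in
    [id^{*n}] is obtained by Cauchy products of Eulerian components: compare the
    coefficients of [n ^ m]. *)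
Lemma euler_coef (W : lmodType k) (F : H -> H -> W) (w : nat -> W) M h :
    is_bilinear F -> (forall m, (M <= m)%N -> w m = 0) ->
    (forall n : nat, \sum_(m < M) n%:R ^+ m *: w m =
       \sw_(a, b <- h) F (cpow id n a) (cpow id n b)) ->
  forall m, w m = \sw_(a, b <- h) \sum_(i < m.+1) F (euler i a) (euler (m - i) b).
Proof.
move=> FB w0 wE m.
have [N [a [b hE]]] := tensor_sum (comul h).
pose K := (M + m.+1 + \max_(l < N) maxn (level (a l)) (level (b l)))%N.
have aK l : (level (a l) <= K)%N.
  apply: leq_trans (leq_addl _ _).
  by apply: leq_trans (leq_bigmax l); rewrite leq_maxl.
have bK l : (level (b l) <= K)%N.
  apply: leq_trans (leq_addl _ _).
  by apply: leq_trans (leq_bigmax l); rewrite leq_maxr.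
have swE (G : H -> H -> W) : is_bilinear G ->
    \sw_(x, y <- h) G x y = \sum_l G (a l) (b l).
  move=> GB; rewrite hE (lin_bigsum _ _ _ (tens_lift_linear GB)).
  by apply: eq_bigr => l _; rewrite tens_liftE.
pose w' j := \sum_l \sum_(i < j.+1) F (euler i (a l)) (euler (j - i) (b l)).
have BE j : is_bilinear (fun x y => \sum_(i < j.+1) F (euler i x) (euler (j - i) y)).
  split=> [y|x] c u v; rewrite scaler_sumr -big_split; apply: eq_bigr => i _ /=.
    by rewrite euler_linear FB.1.
  by rewrite euler_linear FB.2.
rewrite (swE _ (BE m)) -/(w' m).
have MK : (M <= K + K)%N by rewrite !(leq_trans _ (leq_addr _ _)).
have mK : (m < K + K)%N.
  by apply: leq_trans (leq_addr _ _); rewrite /K -addnA addnCA leq_addr.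
apply: (poly_coef_eq char0 _ mK) => n.
rewrite (big_ord_zero_tail (F := fun j => n%:R ^+ j *: w j) MK); last first.
  by move=> j /w0 ->; rewrite scaler0.
rewrite wE swE; last by apply: bil_comp => //; apply: cpow_linear.
under [RHS]eq_bigr => j _ do rewrite scaler_sumr.
rewrite [RHS]exchange_big; apply: eq_bigr => l _.
pose g i j : W := n%:R ^+ (i + j) *: F (euler i (a l)) (euler j (b l)).
transitivity (\sum_(i < K) \sum_(j < K) g i j).
  rewrite (cpow_id_euler _ (aK l)) (cpow_id_euler _ (bK l)).
  rewrite (lin_bigsum _ _ _ (FB.1 _)); apply: eq_bigr => i _.
  rewrite (lin_bigsum _ _ _ (FB.2 _)); apply: eq_bigr => j _.
  by rewrite (bilZl FB) (bilZr FB) scalerA -exprD.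
rewrite cauchy_product; first last.
- move=> i j Kj; rewrite /g (euler_level (leq_trans (bK l) Kj)).
  by rewrite (bil0r FB) scaler0.
- move=> i j Ki; rewrite /g (euler_level (leq_trans (aK l) Ki)).
  by rewrite (bil0l FB) scaler0.
apply: eq_bigr => j _; rewrite scaler_sumr; apply: eq_bigr => i _.
by rewrite /g subnKC // -ltnS.
Qed.

(** The coefficients of [id^{*2n} = id^{*n} * id^{*n}]. *)
Lemma euler_convolution m h :
  (2 ^ m)%:R *: euler m h =
  \sw_(a, b <- h) \sum_(i < m.+1) euler i a * euler (m - i) b.
Proof.
apply: (euler_coef (F := *%R) (w := fun m => (2 ^ m)%:R *: euler m h) (M := level h)).
- exact: bil_mul.
- by move=> j hj; rewrite euler_level // scaler0.
move=> n; rewrite -/(conv (cpow id n) (cpow id n) h) -cpow_add //.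
rewrite addnn -mul2n (cpow_id_euler _ (leqnn _)); apply: eq_bigr => j _.
by rewrite scalerA natrM exprMn natrX mulrC.
Qed.

(** [id^{*n}] multiplies [x ^+ j] by [n ^ j]. *)
Lemma euler_primitive_exp i j (x : H) : primitive_elt x ->
  euler i (x ^+ j) = (i == j)%:R *: x ^+ j.
Proof.
move=> px; pose M := maxn (level (x ^+ j)) (maxn i.+1 j.+1).
have iM : (i < M)%N by rewrite !leq_max leqnn !orbT.
have jM : (j < M)%N by rewrite !leq_max leqnn !orbT.
apply: (poly_coef_eq (v := fun i => euler i (x ^+ j))
  (w := fun i => (i == j)%:R *: x ^+ j) char0 _ iM) => n.
rewrite -cpow_id_euler ?leq_maxl // cpow_id_primitive_exp //.
rewrite (bigD1 (Ordinal jM)) //= eqxx scale1r big1 ?addr0 // => l.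
by rewrite -val_eqE /= => /negPf ->; rewrite scale0r scaler0.
Qed.

Hypothesis cocomm : cocommutative_coalg H.

(** The linear coefficient in [n] of the statement that [id^{*n}] is a coalgebra
    map: as [euler 0] is the unit of convolution, it reads as primitivity. *)
Lemma euler1_primitive h : primitive_elt (euler 1 h).
Proof.
rewrite /primitive_elt.
rewrite (euler_coef (F := @tens k H H) (w := fun m => comul (euler m h))
  (M := level h) (h := h)).
- transitivity (\sw_(a, b <- h)
      (counit a *: (1 ⊗ euler 1 b) + counit b *: (euler 1 a ⊗ 1))).
    apply: eq_tens_lift => a b; rewrite !big_ord_recl big_ord0 addr0 !euler0.
    by rewrite tensZl tensZr.
  rewrite tens_lift_add addrC; congr (_ + _).
    by apply: counit_scaler; apply: lin_comp ((bil_tens _ _).1 _) (euler_linear 1).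
  by apply: counit_scalel; apply: lin_comp ((bil_tens _ _).2 _) (euler_linear 1).
- exact: bil_tens.
- by move=> m hm; rewrite euler_level // (lin0 comul_linear).
move=> n; rewrite -comul_cpow_id // (cpow_id_euler _ (leqnn _)).
rewrite (lin_bigsum _ _ _ comul_linear); apply: eq_bigr => m _.
by rewrite (linZ comul_linear).
Qed.

(** Separating in [euler_convolution] the two terms with [i = 0] and [i = m]
    expresses [(2 ^ m - 2) *: euler m h] by products of components of lower
    index. *)
Lemma primitively_generated (S : set H) : subspace S -> S 1 ->
    (forall x y, S x -> S y -> S (x * y)) -> (forall x, primitive_elt x -> S x) ->
  forall h, S h.
Proof.
move=> subS S1 SM Sprim h.
suff Sm m g : S (euler m g) by rewrite (euler_sum h); apply: subspace_sum.
elim/ltn_ind: m g => {h} -[|[|m]] IH h.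
- by rewrite euler0; apply: subspaceZ.
- exact/Sprim/euler1_primitive.
have c0 : (2 ^ m.+2)%:R - 2%:R != 0 :> k.
  rewrite -natrB; last by rewrite expnS -{1}[2%N]muln1 leq_pmul2l // expn_gt0.
  by rewrite natk_neq0 // subn_eq0 -ltnNge -{1}[2%N]expn1 ltn_exp2l.
apply: (subspace_scaleI subS c0); rewrite scalerBl euler_convolution.
have -> : \sw_(a, b <- h) \sum_(i < m.+3) euler i a * euler (m.+2 - i) b =
   2%:R *: euler m.+2 h +
   \sw_(a, b <- h) \sum_(i < m.+1) euler i.+1 a * euler (m.+1 - i) b.
  rewrite scaler_nat mulr2n -{1}(counit_scalel h (euler_linear m.+2)).
  rewrite -{1}(counit_scaler h (euler_linear m.+2)) -!tens_lift_add.
  apply: eq_tens_lift => a b; rewrite big_ord_recl big_ord_recr /= subn0.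
  rewrite subnn !euler0 -scalerAl -scalerAr mul1r mulr1 [X in _ + X]addrC addrA.
  by congr (_ + _); apply: eq_bigr => i _.
rewrite addrC addKr; apply: subspace_tens_lift => // a b.
apply: subspace_sum => // i _; apply: SM; apply: IH; first by rewrite ltnS.
by rewrite ltnS leq_subLR leq_addl.
Qed.

End Eulerian.

(** * Enveloping algebras are spanned by powers *)

Section Polarization.
Variables (k : fieldType) (A : algType k) (x y : A).

(** The coefficient of [c ^ m] in [(x + c y) ^ n]. *)
Fixpoint polar (n m : nat) : A :=
  match n, m with
  | 0, m => (m == 0%N)%:R
  | n.+1, 0 => x * polar n 0
  | n.+1, m.+1 => x * polar n m.+1 + y * polar n m
  end.

Lemma polar_small n m : (n < m)%N -> polar n m = 0.
Proof.
elim: n m => [|n IH] [|m] //= nm.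
by rewrite !IH ?mulr0 ?addr0 // ltnW.
Qed.

Lemma polarE n (c : k) : (x + c *: y) ^+ n = \sum_(m < n.+1) c ^+ m *: polar n m.
Proof.
elim: n => [|n IH]; first by rewrite big_ord1 !expr0 scale1r.
rewrite exprS IH mulrDl !mulr_sumr big_ord_recl [RHS]big_ord_recl.
rewrite -addrA; congr (_ + _); first by rewrite !expr0 !scale1r.
have polarS m : polar n.+1 m.+1 = x * polar n m.+1 + y * polar n m by [].
under [in RHS]eq_bigr => m _ do rewrite lift0 polarS scalerDr.
rewrite big_split; congr (_ + _).
  rewrite [RHS]big_ord_recr /= polar_small // mulr0 scaler0 addr0.
  by apply: eq_bigr => m _; rewrite -scalerAr.
apply: eq_bigr => m _.
by rewrite -scalerAl -scalerAr scalerA -exprS.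
Qed.

End Polarization.

Section PowerSpan.
Variables (k : fieldType) (L : lieAlgType k).
Hypothesis char0 : [pchar k] =i pred0.
Local Notation U := (envalg L).

(** A linear span, encoded as the intersection of the subspaces that contain the
    generators, so that its elements are reached by instantiating [S]. *)
Definition power_span (n : nat) : set U := fun u =>
  forall S : set U, subspace S -> (forall x j, (j <= n)%N -> S (env_in x ^+ j)) -> S u.

Lemma power_span_subspace n : subspace (power_span n).
Proof.
split=> [S subS _|a u v Su Sv S subS SX]; first exact: subS.1.
by apply: subS.2; [exact: Su | exact: Sv].
Qed.

Lemma power_span_exp n x j : (j <= n)%N -> power_span n (env_in x ^+ j).
Proof. by move=> jn S _; apply. Qed.

Lemma power_span_leq m n u : (m <= n)%N -> power_span m u -> power_span n u.
Proof.
move=> mn Su S subS SX; apply: Su => // x j jm; apply: SX.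
exact: leq_trans mn.
Qed.

(** Multiplication by [y] raises the degree by at most one: the power
    [(x + c y) ^ n.+1] lies in the span for every scalar [c], hence so do its
    coefficients in [c]. The coefficient of [c] is the sum of the words with
    [n] letters [x] and one letter [y], all congruent to [y x ^ n] modulo
    shorter words, and [n.+1] is invertible. The second part is this congruence. *)
Lemma power_span_mull n :
  (forall y u, power_span n u -> power_span n.+1 (env_in y * u)) /\
  (forall x y, power_span n
     (polar (env_in x) (env_in y) n.+1 1 - n.+1%:R *: (env_in y * env_in x ^+ n))).
Proof.
have sub := power_span_subspace.
elim: n => [|n [IHB IHQ]].
  split=> [y u Su|x y]; last first.
    by rewrite /= mulr0 add0r expr0 scale1r subrr; exact: (sub _).1.
  apply: (Su (fun u => power_span 1 (env_in y * u))).
    exact: subspace_preim (lin_mull _) (sub _).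
  move=> x j; rewrite leqn0 => /eqP ->; rewrite expr0 mulr1 -[env_in y]expr1.
  exact: power_span_exp.
have Q x y : power_span n.+1 (polar (env_in x) (env_in y) n.+2 1 -
    n.+2%:R *: (env_in y * env_in x ^+ n.+1)).
  have p0 m : polar (env_in x) (env_in y) m 0 = env_in x ^+ m.
    by elim: m => [|m IH] //=; rewrite IH exprS.
  (* Moving [y] to the left across one letter [x] costs a commutator. *)
  have -> :
     polar (env_in x) (env_in y) n.+2 1 - n.+2%:R *: (env_in y * env_in x ^+ n.+1)
     = env_in x * (polar (env_in x) (env_in y) n.+1 1
         - n.+1%:R *: (env_in y * env_in x ^+ n))
       - n.+1%:R *: (env_in (lie y x) * env_in x ^+ n).
    rewrite -[polar _ _ n.+2 1]/(env_in x * polar (env_in x) (env_in y) n.+1 1 +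
      env_in y * polar (env_in x) (env_in y) n.+1 0) p0.
    rewrite env_in_lie mulrBr mulrBl -scalerAr scalerBr -!mulrA -exprS.
    rewrite -[n.+2%:R]natr1 scalerDl scale1r opprD addrACA subrr addr0.
    by rewrite opprB addrA subrK.
  apply: (subspaceB (sub _)); first by apply: IHB; apply: IHQ.
  by apply: (subspaceZ (sub _)); apply: IHB; apply: power_span_exp.
split=> // y u Su; apply: (Su (fun u => power_span n.+2 (env_in y * u))).
  exact: subspace_preim (lin_mull _) (sub _).
move=> x j; rewrite leq_eqVlt => /orP[/eqP ->|jn]; last first.
  apply: (power_span_leq (leqnSn _)); apply: IHB; exact: power_span_exp.
have : power_span n.+2 (polar (env_in x) (env_in y) n.+2 1).
  apply: (poly_coef_subspace (M := n.+3)
    (v := polar (env_in x) (env_in y) n.+2) char0 (sub _)) => // c.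
  rewrite -polarE -(linZ (@env_in_linear _ _)) -(linD (@env_in_linear _ _)).
  exact: power_span_exp.
move=> P; have n0 : n.+2%:R != 0 :> k by rewrite natk_neq0.
apply: (subspace_scaleI (sub _) n0).
have := subspaceB (sub _) P (power_span_leq (leqnSn _) (Q x y)).
by rewrite opprB addrC subrK.
Qed.

Lemma env_power_ind (S : set U) : subspace S ->
  (forall x n, S (env_in x ^+ n)) -> forall u, S u.
Proof.
move=> subS SX u; suff [n Su] : exists n, power_span n u.
  by apply: Su => // x j _; apply: SX.
elim/env_indl: u => [||u v [m Su] [n Sv]|a u [n Su]|x u [n Su]].
- by exists 0%N; exact: (power_span_subspace 0).1.
- by exists 0%N => S' _ /(_ 0 0%N (leqnn _)); rewrite expr0.
- exists (maxn m n); apply: (subspaceD (power_span_subspace _)).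
    by apply: power_span_leq Su; exact: leq_maxl.
  by apply: power_span_leq Sv; exact: leq_maxr.
- by exists n; apply: (subspaceZ (power_span_subspace n)).
- by exists n.+1; apply: (power_span_mull n).1.
Qed.

End PowerSpan.

(** * The Lie algebra of primitive elements *)

Section Primitives.
Variables (k : fieldType) (H : hopfAlgType k).

Definition primitive_pred : {pred H} := fun x => `[< primitive_elt x >].

Lemma primitive_submod : submod_closed primitive_pred.
Proof.
split=> [|a x y].
  apply/asboolP; rewrite /primitive_elt (lin0 comul_linear).
  by rewrite tens0l tens0r addr0.
move=> /asboolP px /asboolP py; apply/asboolP.
rewrite /primitive_elt comul_linear px py scalerDr addrACA.
by rewrite !tensDl !tensDr tensZl tensZr.
Qed.

HB.instance Definition _ :=
  GRing.isSubmodClosed.Build k H primitive_pred primitive_submod.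

Record primitives := Primitive {
  prim_val : H;
  _ : prim_val \in primitive_pred
}.

HB.instance Definition _ := [isSub for prim_val].
HB.instance Definition _ := [Choice of primitives by <:].
HB.instance Definition _ := [SubChoice_isSubLmodule of primitives by <:].

Definition prim_of (x : H) (px : primitive_elt x) : primitives :=
  Primitive (introT (asboolP _) px).

Lemma prim_valP (x : primitives) : primitive_elt (prim_val x).
Proof. by apply/asboolP; case: x. Qed.

Lemma prim_val_inj : injective prim_val.
Proof. exact: val_inj. Qed.

Lemma prim_val_linear : linear prim_val.
Proof. by []. Qed.

Lemma primitive_commutator (x y : H) : primitive_elt x -> primitive_elt y ->
  primitive_elt (x * y - y * x).
Proof.
move=> px py; rewrite /primitive_elt (linD comul_linear) (linN comul_linear) !comulM.
rewrite px py !(mulrDl, mulrDr) !tensor_mulE !mulr1 !mul1r.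
by rewrite tensDl tensDr tensNl tensNr !opprD; symmetry; exact: bracket_aux.
Qed.

Definition prim_lie (x y : primitives) : primitives :=
  prim_of (primitive_commutator (prim_valP x) (prim_valP y)).

Let prim_lieE x y :
  prim_val (prim_lie x y) = prim_val x * prim_val y - prim_val y * prim_val x.
Proof. by []. Qed.

Let lie_bil : is_bilinear prim_lie.
Proof.
split=> [y a u v|y a u v]; apply: prim_val_inj.
  rewrite prim_val_linear !prim_lieE prim_val_linear.
  by rewrite (bil_mul H).1 (bil_mul H).2 opprD scalerBr addrACA.
rewrite prim_val_linear !prim_lieE prim_val_linear.
by rewrite (bil_mul H).1 (bil_mul H).2 opprD scalerBr addrACA.
Qed.

Let lie_xx x : prim_lie x x = 0.
Proof. by apply: prim_val_inj; rewrite /= subrr. Qed.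

Let lie_jac x y z :
  prim_lie x (prim_lie y z) + prim_lie y (prim_lie z x) + prim_lie z (prim_lie x y) = 0.
Proof.
apply: prim_val_inj; rewrite !(linD prim_val_linear) !prim_lieE.
move: (prim_val x) (prim_val y) (prim_val z) => a b c.
rewrite !(mulrBl, mulrBr) !mulrA !opprB.
rewrite [LHS](AC ((2*2)*(2*2)*(2*2)) ((1*12)*(7*2)*(3*10)*(5*4)*(11*6)*(9*8))).
by rewrite /= !subrr !addr0.
Qed.

HB.instance Definition _ := Lmodule_isLie.Build k primitives lie_bil lie_xx lie_jac.

Lemma prim_val_lie (x y : primitives) :
  prim_val (lie x y) = prim_val x * prim_val y - prim_val y * prim_val x.
Proof. by []. Qed.

End Primitives.

(** * The Cartier-Milnor-Moore isomorphism *)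

Section CanonicalMap.
Variables (k : fieldType) (H : hopfAlgType k).
Local Notation L := (primitives H).
Local Notation U := (envalg L).

Definition env_prim : U -> H := env_lift 1 *%R (@prim_val k H).

Let B := bil_mul H.
Let vL := @prim_val_linear k H.
Let vlie := @prim_val_lie k H.

Lemma env_prim_linear : linear env_prim.
Proof. exact: (env_lift_linear_gen B (@mulrA _) (@mul1r _) (@mulr1 _) vL vlie). Qed.

Lemma env_primM u v : env_prim (u * v) = env_prim u * env_prim v.
Proof. exact: (env_liftM_gen B (@mulrA _) (@mul1r _) (@mulr1 _) vL vlie). Qed.

Lemma env_prim1 : env_prim 1 = 1.
Proof. exact: (env_lift1_gen B (@mulrA _) (@mul1r _) (@mulr1 _) vL vlie). Qed.

Lemma env_prim_in x : env_prim (env_in x) = prim_val x.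
Proof. exact: (env_lift_in_gen B (@mulrA _) (@mul1r _) (@mulr1 _) vL vlie). Qed.

Lemma env_primX u n : env_prim (u ^+ n) = env_prim u ^+ n.
Proof. by elim: n => [|n IH]; rewrite ?expr0 ?env_prim1 // !exprS env_primM IH. Qed.

Lemma env_prim_hopf : is_hopf_morphism env_prim.
Proof.
have L1 := env_prim_linear.
have MB : is_bilinear (fun a b => env_prim a ⊗ env_prim b).
  exact: (bil_comp (bil_tens _ _) L1 L1).
split; [exact: L1 | exact: env_primM | exact: env_prim1 | move=> u | move=> u].
  apply: (@env_ext _ _ _ _ _ (lin_comp comul_linear L1) (sw_linear MB)) u.
    by rewrite env_prim1 [LHS]comul1 [in RHS]comul1 tens_liftE // env_prim1.
  move=> x u IH; rewrite [in RHS]env_swM // env_primM comulM IH env_prim_in.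
  rewrite prim_valP (linear_tens_lift _ _ ((@tensor_mul_bilinear _ _ _).2 _)).
  apply: eq_tens_lift => a b.
  by rewrite mulrDl !tensor_mulE !mul1r !env_primM env_prim_in.
have cL : linear (counit : U -> k^o) by exact: counit_linear.
have cL' : linear (fun u => counit (env_prim u) : k^o).
  exact: (@lin_comp k _ _ k^o _ _ (@counit_linear _ _) L1).
apply: (@env_ext _ _ k^o _ _ cL' cL) u => [|x u IH].
  by rewrite env_prim1 [LHS]counit1 [RHS]counit1.
rewrite env_primM counitM [RHS]counitM env_prim_in (primitive_counit (prim_valP x)).
by rewrite [counit (env_in _)]env_counit_in !mul0r.
Qed.

Hypothesis char0 : [pchar k] =i pred0.
Hypothesis cocomm : cocommutative_coalg H.
Hypothesis conil : forall h : H, exists n, fil n h.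

(** [log id], valued in the enveloping algebra instead of [H]. *)
Definition log_env (h : H) : U :=
  env_in (prim_of (euler1_primitive char0 conil cocomm h)).

Lemma log_env_linear : linear log_env.
Proof.
move=> a u v; rewrite /log_env -env_in_linear; congr env_in.
by apply: prim_val_inj; rewrite prim_val_linear /= euler_linear.
Qed.

Lemma log_env_exp (x : L) i : log_env (prim_val x ^+ i) = (i == 1%N)%:R *: env_in x.
Proof.
rewrite /log_env -(linZ (@env_in_linear _ _)); congr env_in.
apply: prim_val_inj; rewrite (linZ (@prim_val_linear _ _)) /=.
rewrite (euler_primitive_exp char0 conil _ _ (prim_valP x)) eq_sym.
by have [->|_] := eqVneq i 1%N; rewrite ?expr1 // !scale0r.
Qed.

(** A truncated exponential of [log_env] inverts [env_prim] on each power of an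
    element of [L], hence on the whole enveloping algebra. *)
Lemma exp_log_env u : exists M, forall N, (M <= N)%N ->
  \sum_(m < N) (m`!%:R)^-1 *: cpow log_env m (env_prim u) = u.
Proof.
have cL m : linear (fun u => cpow log_env m (env_prim u)).
  exact: lin_comp (cpow_linear log_env_linear m) env_prim_linear.
apply: (env_power_ind char0 (S := fun u => exists M, forall N, (M <= N)%N ->
  \sum_(m < N) (m`!%:R)^-1 *: cpow log_env m (env_prim u) = u)) u.
  split=> [|a u v [M uM] [M' vM']].
    by exists 0%N => N _; rewrite big1 // => m _; rewrite (lin0 (cL m)) scaler0.
  exists (maxn M M') => N; rewrite geq_max => /andP[MN M'N].
  rewrite -[in RHS](uM N) // -[in RHS](vM' N) // scaler_sumr -big_split.
  by apply: eq_bigr => m _; rewrite cL scalerDr !scalerA mulrC.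
move=> x n; exists n.+1 => N nN; rewrite (bigD1 (Ordinal nN)) //= big1 => [|m].
  rewrite env_primX env_prim_in.
  rewrite (cpow_primitive_exp (prim_valP x) _ _ log_env_linear (log_env_exp x)).
  by rewrite eqxx mul1r scalerA mulVf ?factk_neq0 // scale1r addr0.
rewrite -val_eqE /= => /negPf mn; rewrite env_primX env_prim_in.
rewrite (cpow_primitive_exp (prim_valP x) _ _ log_env_linear (log_env_exp x)) mn.
by rewrite mul0r scale0r scaler0.
Qed.

Lemma env_prim_inj : injective env_prim.
Proof.
move=> u v uv; have [M uM] := exp_log_env u; have [N vN] := exp_log_env v.
by rewrite -(uM (maxn M N)) ?leq_maxl // -[RHS](vN (maxn M N)) ?leq_maxr // uv.
Qed.

Lemma env_prim_surj h : exists u, h = env_prim u.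
Proof.
apply: (primitively_generated char0 conil cocomm
  (S := fun h => exists u, h = env_prim u)).
- exact: subspace_image env_prim_linear.
- by exists 1; rewrite env_prim1.
- by move=> _ _ [u ->] [v ->]; exists (u * v); rewrite env_primM.
- by move=> x px; exists (env_in (prim_of px)); rewrite env_prim_in.
Qed.

End CanonicalMap.

Section HopfMorphisms.
Variable k : fieldType.

Lemma hopf_morphism_primitive (A B : hopfAlgType k) (f : A -> B) x :
  is_hopf_morphism f -> primitive_elt x -> primitive_elt (f x).
Proof.
move=> fH px; have fL := hm_linear fH.
have MB : is_bilinear (fun a b => f a ⊗ f b) by exact: (bil_comp (bil_tens _ _) fL fL).
rewrite /primitive_elt (hm_comul fH) px (linD (tens_lift_linear MB)) !tens_liftE //.
by rewrite (hm_one fH).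
Qed.

Lemma hopf_morphism_inverse (A B : hopfAlgType k) (f : A -> B) (g : B -> A) :
  is_hopf_morphism f -> cancel f g -> cancel g f -> is_hopf_morphism g.
Proof.
move=> [fL fM f1 fD fC] fK gK.
have gL : linear g by move=> a u v; apply: (can_inj fK); rewrite fL !gK.
split=> //.
- by move=> a b; apply: (can_inj fK); rewrite fM !gK.
- by apply: (can_inj fK); rewrite f1 gK.
- move=> b; have MB : is_bilinear (fun a b => g a ⊗ g b).
    exact: (bil_comp (bil_tens _ _) gL gL).
  rewrite -[in RHS](gK b) fD (linear_tens_lift _ _ (tens_lift_linear MB)).
  rewrite -[LHS]tens_lift_id; apply: eq_tens_lift => x y.
  by rewrite tens_liftE // !fK.
- by move=> b; rewrite -fC gK.
Qed.

End HopfMorphisms.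

(** * Crossed modules *)

Section PrimitiveXMod.
Variables (k : fieldType) (X : hopfXMod k).
Local Notation B := (hx_src X).
Local Notation H := (hx_tgt X).
Local Notation gamma := (@hx_map k X).
Local Notation act := (@hx_act k X).

Let actB : is_bilinear act := ma_bilinear (hx_act_action X).

(** The two mixed terms vanish because [h] sends [1] to [counit h *: 1 = 0]. *)
Lemma primitive_act h b : primitive_elt h -> primitive_elt b -> primitive_elt (act h b).
Proof.
move=> ph pb; have aB := actB.
have B1 h1 h2 : is_bilinear (fun b1 b2 => act h1 b1 ⊗ act h2 b2).
  exact: bil_comp (bil_tens _ _) (aB.2 h1) (aB.2 h2).
have B2 : is_bilinear (fun h1 h2 => \sw_(b1, b2 <- b) act h1 b1 ⊗ act h2 b2).
  apply: tens_lift_bilinear => b1 b2.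
  exact: bil_comp (bil_tens _ _) (aB.1 b1) (aB.1 b2).
rewrite /primitive_elt (mco_comul (hx_act_coalgebra X)) ph.
rewrite (linD (tens_lift_linear B2)) !tens_liftE // pb.
rewrite !(linD (tens_lift_linear (B1 _ _))) !tens_liftE //.
rewrite !(ma_one (hx_act_action X)) !(mal_one (hx_act_algebra X)).
by rewrite (primitive_counit ph) scale0r tens0l tens0r addr0 add0r.
Qed.

Lemma primitive_act_mul h b c : primitive_elt h ->
  act h (b * c) = act h b * c + b * act h c.
Proof.
move=> ph; have aB := actB.
have B1 : is_bilinear (fun h1 h2 => act h1 b * act h2 c).
  exact: bil_comp (bil_mul _) (aB.1 b) (aB.1 c).
rewrite (mal_mul (hx_act_algebra X)) ph (linD (tens_lift_linear B1)) !tens_liftE //.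
by rewrite !(ma_one (hx_act_action X)).
Qed.

Lemma primitive_conj (A : hopfAlgType k) (x c : A) : primitive_elt x ->
  (\sw_(a, b <- x) a * c * antipode b) = x * c - c * x.
Proof.
move=> px; have B1 : is_bilinear (fun a b : A => a * c * antipode b).
  exact: bil_comp (bil_mul A) (lin_mulr c) antipode_linear.
rewrite px (linD (tens_lift_linear B1)) !tens_liftE // hopf_antipode1 mulr1 mul1r.
by rewrite (primitive_antipode px) mulrN.
Qed.

Local Notation PB := (primitives B).
Local Notation PH := (primitives H).

Definition prim_map (x : PB) : PH :=
  prim_of (hopf_morphism_primitive (hx_map_morphism X) (prim_valP x)).

Definition prim_act (h : PH) (b : PB) : PB :=
  prim_of (primitive_act (prim_valP h) (prim_valP b)).

Let gammaL : linear gamma := hm_linear (hx_map_morphism X).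
Let gammaM a b : gamma (a * b) = gamma a * gamma b := hm_mul (hx_map_morphism X) a b.

Lemma prim_map_linear : linear prim_map.
Proof. by move=> a u v; apply: prim_val_inj; rewrite prim_val_linear /= gammaL. Qed.

Lemma prim_map_lie x y : prim_map (lie x y) = lie (prim_map x) (prim_map y).
Proof.
by apply: prim_val_inj; rewrite /= (linD gammaL) (linN gammaL) !gammaM.
Qed.

Lemma prim_act_bilinear : is_bilinear prim_act.
Proof.
split=> [b a u v|h a u v]; apply: prim_val_inj; rewrite prim_val_linear /=.
  by rewrite actB.1.
by rewrite actB.2.
Qed.

Lemma prim_act_lie n n' m :
  prim_act (lie n n') m = prim_act n (prim_act n' m) - prim_act n' (prim_act n m).
Proof.
have vL := @prim_val_linear k B.
apply: prim_val_inj; rewrite (linD vL) (linN vL) /=.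
by rewrite (bilDl actB) (bilNl actB) !(ma_mul (hx_act_action X)).
Qed.

Lemma prim_act_derivation n m m' :
  prim_act n (lie m m') = lie (prim_act n m) m' + lie m (prim_act n m').
Proof.
apply: prim_val_inj; rewrite (linD (@prim_val_linear _ _)) /=.
rewrite (bilDr actB) (bilNr actB) !primitive_act_mul; try exact: prim_valP.
by rewrite [X in _ - X]addrC opprD addrACA.
Qed.

Lemma prim_equivariance n m : prim_map (prim_act n m) = lie n (prim_map m).
Proof.
by apply: prim_val_inj; rewrite /= hx_equivariance primitive_conj //; exact: prim_valP.
Qed.

Lemma prim_peiffer m m' : prim_act (prim_map m) m' = lie m m'.
Proof.
by apply: prim_val_inj; rewrite /= hx_peiffer primitive_conj //; exact: prim_valP.
Qed.

Definition prim_xmod : lieXMod k := LieXMod prim_map_linear prim_map_lie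
  prim_act_bilinear prim_act_lie prim_act_derivation prim_equivariance prim_peiffer.

Lemma env_prim_map u : gamma (env_prim u) = env_prim (env_map prim_map u).
Proof.
have mL := env_map_linear prim_map_linear prim_map_lie.
apply: (@env_ext _ _ _ _ _ (lin_comp gammaL (@env_prim_linear k B))
  (lin_comp (@env_prim_linear k H) mL)) u => [|x u IH].
  rewrite env_prim1 (hm_one (hx_map_morphism X)).
  by rewrite (env_map1 prim_map_linear prim_map_lie) env_prim1.
rewrite env_primM gammaM IH (env_mapM prim_map_linear prim_map_lie) env_primM.
by rewrite (env_map_in prim_map_linear prim_map_lie) !env_prim_in.
Qed.

(** A primitive element acts on both sides as a derivation, so that comparing
    on generators of the two enveloping algebras suffices. *)
Lemma env_prim_act h b :
  env_prim (env_act prim_act h b) = act (env_prim h) (env_prim b).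
Proof.
have eL := @env_prim_linear k B; have eL' := @env_prim_linear k H.
have dL x := prim_act_bilinear.2 x; have dD x := prim_act_derivation x.
have DL x := env_der_linear (dL x) (dD x).
have der x c : env_prim (env_der (prim_act x) c) = act (prim_val x) (env_prim c).
  have RL := lin_comp (actB.2 (prim_val x)) eL.
  apply: (@env_ext _ _ _ _ _ (lin_comp eL (DL x)) RL) c => [|y c IH].
    rewrite (env_der1 (dL x) (dD x)) (lin0 eL) env_prim1 (mal_one (hx_act_algebra X)).
    by rewrite (primitive_counit (prim_valP x)) scale0r.
  rewrite (env_derM (dL x) (dD x)) (linD eL) !env_primM IH (env_der_in (dL x) (dD x)).
  by rewrite !env_prim_in primitive_act_mul //; apply: prim_valP.
have aB := env_act_bilinear prim_act_bilinear prim_act_lie prim_act_derivation.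
have RL := lin_comp (actB.1 (env_prim b)) eL'.
apply: (@env_ext _ _ _ _ _ (lin_comp eL (aB.1 b)) RL) h => [|x h IH].
  rewrite (env_act1 prim_act_bilinear prim_act_lie prim_act_derivation).
  by rewrite env_prim1 (ma_one (hx_act_action X)).
rewrite (env_actM prim_act_bilinear prim_act_lie prim_act_derivation).
rewrite (env_act_in prim_act_bilinear prim_act_lie prim_act_derivation).
by rewrite der IH env_primM env_prim_in (ma_mul (hx_act_action X)).
Qed.

End PrimitiveXMod.

Theorem corollary2 (k : fieldType) (k_char0 : [pchar k] =i pred0)
    (X : hopfXMod k)
    (src_irr : irreducible_coalg (hx_src X))
    (src_cocomm : cocommutative_coalg (hx_src X))
    (tgt_irr : irreducible_coalg (hx_tgt X))
    (tgt_cocomm : cocommutative_coalg (hx_tgt X)) :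
  exists mu : lieXMod k, hopfXMod_iso X (env_xmod mu).
Proof.
have inverse (A : hopfAlgType k) (irr : irreducible_coalg A)
    (cocomm : cocommutative_coalg A) :
    exists g, cancel (@env_prim k A) g /\ cancel g (@env_prim k A).
  have conil := fil_exhaustive irr cocomm.
  have [g gK] := choice (env_prim_surj k_char0 cocomm conil).
  exists g; split=> [u|h]; last by rewrite -gK.
  by apply: (env_prim_inj k_char0 cocomm conil); rewrite -gK.
have [g [eK gK]] := inverse _ src_irr src_cocomm.
have [g' [eK' gK']] := inverse _ tgt_irr tgt_cocomm.
have eH := env_prim_hopf (hx_src X); have eH' := env_prim_hopf (hx_tgt X).
have gH := hopf_morphism_inverse eH eK gK.
have gH' := hopf_morphism_inverse eH' eK' gK'.
exists (prim_xmod X).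
have fmap b : env_map (@prim_map k X) (g b) = g' (hx_map b).
  by apply: (can_inj eK'); rewrite -env_prim_map gK gK'.
have fact h b : g (hx_act h b) = env_act (@prim_act k X) (g' h) (g b).
  by apply: (can_inj eK); rewrite env_prim_act !gK gK'.
pose f : hopfXMod_hom X (env_xmod (prim_xmod X)) :=
  @HopfXModHom k X (env_xmod (prim_xmod X)) g g' gH gH' fmap fact.
pose e : hopfXMod_hom (env_xmod (prim_xmod X)) X :=
  @HopfXModHom k (env_xmod (prim_xmod X)) X _ _ eH eH'
    (@env_prim_map k X) (@env_prim_act k X).
by exists f, e.
Qed.
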